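(* Let $X^\#$ be a computably compact presentation of a compact Polish space $X$. Then there exists a computable presentation of $C^*(X)$ that is evaluative over $X^\#$, and it is unique up to computable isometric isomorphism: any two computable presentations of $C^*(X)$ that are evaluative over $X^\#$ are computably isometrically isomorphic.
   Context: For a compact Polish space $X$, $C^*(X)$ is the commutative unital $C^*$-algebra of continuous functions $X\to\mathbb{C}$ with the sup norm, pointwise operations and complex conjugation as involution. A presentation of a metric space $(M,d)$ is $M^\#=(M,(s_n)_{n\in\mathbb{N}})$ with $(s_n)$ dense (distinguished points); a presentation of a compact Polish space $X$ is $X^\#=(X,d,(p_n))$ with $d$ a compatible metric and $(p_n)$ dense. $M^\#$ is computable if $d(s_j,s_k)$ is computable uniformly in $j,k$. A name of $x$ is a sequence $(n_k)$ with $d(s_{n_k},x)<2^{-k}$; a map between presented spaces is computable if some oracle Turing machine transforms every name of any input into a name of its image; $\mathbb{C}$ has its standard presentation. A total boundedness function of $M^\#$ is $f:\mathbb{N}\to\mathbb{N}$ such that for each $j$, $f(j)$ codes a finite $F\subseteq\mathbb{N}$ with $M=\bigcup_{k\in F}B(s_k;2^{-j})$. $M^\#$ is computably compact if it is computable and has a computable total boundedness function. Fix an effective enumeration $(\mathfrak{p}_n)$ of the $*$-polynomials with coefficients in $\mathbb{Q}(i)$ in variables $x_0,x_1,\dots$. A presentation of a $C^*$-algebra $A$ is $A^\#=(A,(u_n))$ such that the rational vectors $\mathfrak{p}_n[A^\#]$ (substitute $u_j$ for $x_j$) are dense in $A$; it is computable if $\|\mathfrak{p}_n[A^\#]\|$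 is computable uniformly in $n$; it is regarded as a presented metric space with the rational vectors as distinguished points. Two presentations of $A$ are computably isometrically isomorphic if there is an isometric $*$-isomorphism $A\to A$ which is a computable map between them. Given $X^\#=(X,d_0,(p_n))$ and $C^*(X)^\#$ with rational vectors $(\rho_m)$, and a computable bijection $n\mapsto((n)_0,(n)_1)$ of $\mathbb{N}$ onto $\mathbb{N}^2$, $(C^*(X)\times X)^\#$ is the presented metric space with metric $\max\{\|u-v\|,d_0(p,q)\}$ and $n$-th distinguished point $(\rho_{(n)_0},p_{(n)_1})$. $C^*(X)^\#$ is evaluative over $X^\#$ if $(f,p)\mapsto f(p)$ is a computable map from $(C^*(X)\times X)^\#$ to $\mathbb{C}$. *)

(* Defs.v *)
From HB Require Import structures.
From mathcomp Require Import all_boot all_order all_algebra.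
From mathcomp Require Import all_classical all_reals all_analysis.
From mathcomp Require Import complex.

Set Implicit Arguments.
Unset Strict Implicit.
Unset Printing Implicit Defensive.

Import Order.TTheory GRing.Theory Num.Theory.
Import numFieldNormedType.Exports.

Local Open Scope classical_set_scope.
Local Open Scope ring_scope.

(* Computability on nat relative to an oracle o : nat -> nat: Kleene's schemes
   for partial recursive functions plus one scheme that queries the oracle.
   [rec_eval o c xs y] reads: the computation of c on the arguments xs with
   oracle o halts with output y. Missing arguments read as 0, extra ones are
   ignored. *)
Inductive recfun : Type :=
| RZero
| RSucc
| RProj of nat
| ROracle
| RComp of recfun & seq recfun
| RPrec of recfun & recfun
| RMu of recfun.

Fixpoint rec_eval (o : nat -> nat) (c : recfun) (xs : seq nat) (y : nat) : Prop :=
  match c with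
  | RZero => y = 0%N
  | RSucc => y = (head 0%N xs).+1
  | RProj i => y = nth 0%N xs i
  | ROracle => y = o (head 0%N xs)
  | RComp f gs => exists2 ys,
      (fix evs (gs : seq recfun) (ys : seq nat) : Prop :=
         match gs, ys with
         | [::], [::] => True
         | g :: gs', z :: ys' => rec_eval o g xs z /\ evs gs' ys'
         | _, _ => False
         end) gs ys & rec_eval o f ys y
  | RPrec f g => (* s i = value at recursion argument i *)
      exists s : nat -> nat,
      [/\ rec_eval o f (behead xs) (s 0%N),
          forall i, (i < head 0 xs)%N ->
            rec_eval o g [:: i, s i & behead xs] (s i.+1)
        & y = s (head 0%N xs)]
  | RMu f =>
      rec_eval o f (y :: xs) 0%N /\
      forall m, (m < y)%N -> exists z, rec_eval o f (m :: xs) z.+1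
  end.

(* Absence of an oracle is rendered by the constantly zero oracle. *)
Definition no_oracle : nat -> nat := fun=> 0%N.

Definition computable_nat (f : nat -> nat) : Prop :=
  exists c, forall n, rec_eval no_oracle c [:: n] (f n).

(* Effective codings. [CodeSeq.decode] is a bijection of nat onto seq nat with
   decode 0 = [::] and decode (2 ^ a * (2 * b + 1)) = a :: decode b; [unpair] is
   the corresponding bijection of nat onto nat * nat. *)
Definition unpair (n : nat) : nat * nat :=
  (logn 2 n.+1, (n.+1 %/ 2 ^ logn 2 n.+1)./2)%N.

Definition rat_of_code (n : nat) : rat :=
  let: (a, d) := unpair n in
  let: (p, q) := unpair a in (p%:R - q%:R) / d.+1%:R.

(* Gaussian rationals Q(i), as pairs (real part, imaginary part). *)
Definition qi_of_code (n : nat) : rat * rat :=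
  (rat_of_code (unpair n).1, rat_of_code (unpair n).2).

(* A *-polynomial is a formal sum of terms (c, w), with c in Q(i) and w a word
   in the letters (j, false), standing for x_j, and (j, true), standing for the
   adjoint of x_j. *)
Definition starpoly : Type := seq ((rat * rat) * seq (nat * bool)).

Definition starpoly_of_code (n : nat) : starpoly :=
  [seq (qi_of_code (unpair m).1,
        [seq (l./2, odd l) | l <- CodeSeq.decode (unpair m).2])
  | m <- CodeSeq.decode n].

Section Presentations.
Context {R : realType}.

Definition computable_reals (r : nat -> R) : Prop :=
  exists c, forall n k, exists2 q, rec_eval no_oracle c [:: n; k] q &
    `|r n - ratr (rat_of_code q)| < 2 ^- k.

Definition computable_reals2 (r : nat -> nat -> R) : Prop :=
  exists c, forall i j k, exists2 q, rec_eval no_oracle c [:: i; j; k] q &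
    `|r i j - ratr (rat_of_code q)| < 2 ^- k.

Definition is_metric (M : Type) (d : M -> M -> R) : Prop :=
  [/\ forall x y, d x y = 0 <-> x = y,
      forall x y, d x y = d y x
    & forall x y z, d x z <= d x y + d y z].

(* A metric together with a sequence of distinguished points. *)
Record presented (M : Type) := Presented {
  pdist : M -> M -> R ;
  ppoint : nat -> M
}.

Definition dense_points (M : Type) (P : presented M) : Prop :=
  forall x e, 0 < e -> exists n, pdist P (ppoint P n) x < e.

Definition computable_presentation (M : Type) (P : presented M) : Prop :=
  computable_reals2 (fun j k => pdist P (ppoint P j) (ppoint P k)).

Definition is_name (M : Type) (P : presented M) (x : M) (a : nat -> nat) : Prop :=
  forall k, pdist P (ppoint P (a k)) x < 2 ^- k.

Definition computable_map (M N : Type) (P : presented M) (Q : presented N)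
    (F : M -> N) : Prop :=
  exists c, forall x a, is_name P x a ->
    exists2 b, (forall k, rec_eval a c [:: k] (b k)) & is_name Q (F x) b.

Definition total_boundedness_function (M : Type) (P : presented M)
    (f : nat -> nat) : Prop :=
  forall j, [set: M] =
    \bigcup_(k in [set` CodeSeq.decode (f j)])
      [set x | pdist P (ppoint P k) x < 2 ^- j].

Definition computably_compact (M : Type) (P : presented M) : Prop :=
  computable_presentation P /\
  exists2 f, computable_nat f & total_boundedness_function P f.

Definition prod_presented (pr : nat -> nat * nat) (M N : Type)
    (P : presented M) (Q : presented N) : presented (M * N) :=
  Presented (fun u v => Num.max (pdist P u.1 v.1) (pdist Q u.2 v.2))
            (fun n => (ppoint P (pr n).1, ppoint Q (pr n).2)).

Definition computable_bijection (pr : nat -> nat * nat) : Prop :=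
  [/\ bijective pr, computable_nat (fun n => (pr n).1)
    & computable_nat (fun n => (pr n).2)].

Definition compatible_metric (X : topologicalType) (d : X -> X -> R) : Prop :=
  is_metric d /\
  forall (x : X) (A : set X),
    nbhs x A <-> exists2 e, 0 < e & [set y | d x y < e] `<=` A.

Definition complete_metric (M : Type) (d : M -> M -> R) : Prop :=
  forall s : nat -> M,
    (forall e, 0 < e -> exists N, forall m n,
       (N <= m)%N -> (N <= n)%N -> d (s m) (s n) < e) ->
    exists x, forall e, 0 < e -> exists N, forall n, (N <= n)%N -> d (s n) x < e.

Definition polish (X : topologicalType) : Prop :=
  (exists2 d : X -> X -> R, compatible_metric d & complete_metric d) /\
  (exists2 S : set X, countable S & dense S).

Definition space_presentation (X : topologicalType) (P : presented X) : Prop :=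
  compatible_metric (pdist P) /\ dense_points P.

Definition qi_val (c : rat * rat) : R[i] := (ratr c.1 +i* ratr c.2)%C.

Definition complex_presented : presented R[i] :=
  Presented (fun z w => ComplexField.Normc.normc (z - w))
            (fun n => qi_val (qi_of_code n)).

End Presentations.
Arguments presented : clear implicits.
Arguments polish : clear implicits.

(* C*(X): the library type of continuous functions X -> C, with the pointwise
   operations. The codomain is written R[i]^o because that alias of R[i] carries
   the topology (of the modulus). *)
Definition cstar (R : realType) (X : topologicalType) : Type :=
  continuousType X R[i]^o.

Section CstarAlgebra.
Context {R : realType} {X : topologicalType}.
Local Notation C := R[i]^o.
Local Notation A := (cstar R X).
Implicit Types f g h : A.

HB.instance Definition _ := Choice.on A.

Lemma cf_add_cts f g : continuous (fun x : X => (f x : C) + g x).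
Proof. by move=> x; apply: cvgD; apply: cts_fun. Qed.
Lemma cf_opp_cts f : continuous (fun x : X => - (f x : C)).
Proof. by move=> x; apply: cvgN; apply: cts_fun. Qed.
Lemma cf_mul_cts f g : continuous (fun x : X => (f x : C) * g x).
Proof. by move=> x; apply: cvgM; apply: cts_fun. Qed.
Lemma cf_scale_cts (c : R[i]) f : continuous (fun x : X => c *: (f x : C)).
Proof. by move=> x; apply: cvgZr; apply: cts_fun. Qed.
Lemma cf_adj_cts f : continuous (fun x : X => conjc (f x) : C).
Proof.
move=> x; apply/(@cvgrPdist_lt _ C) => e e0.
have /(@cvgrPdist_lt _ C)/(_ e e0) := @cts_fun _ _ f x.
apply: filterS => y; rewrite -rmorphB /=.
by rewrite !normc_def; case: (f x - f y) => a b /=; rewrite sqrrN.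
Qed.
Lemma cf_cst_cts (c : R[i]) : continuous (fun _ : X => c : C).
Proof. by move=> x; apply: cvg_cst. Qed.

Definition cf_cst (c : R[i]) : A := mkcts (@cf_cst_cts c).
Definition cf_add f g : A := mkcts (@cf_add_cts f g).
Definition cf_opp f : A := mkcts (@cf_opp_cts f).
Definition cf_mul f g : A := mkcts (@cf_mul_cts f g).
Definition cf_scale (c : R[i]) f : A := mkcts (@cf_scale_cts c f).
Definition cf_adj f : A := mkcts (@cf_adj_cts f).

Lemma cf_addA : associative cf_add.
Proof. by move=> f g h; apply/continuousEP => x /=; rewrite [LHS]addrA. Qed.
Lemma cf_addC : commutative cf_add.
Proof. by move=> f g; apply/continuousEP => x /=; rewrite [LHS]addrC. Qed.
Lemma cf_add0 : left_id (cf_cst 0) cf_add.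
Proof. by move=> f; apply/continuousEP => x /=; rewrite [LHS]add0r. Qed.
Lemma cf_addN : left_inverse (cf_cst 0) cf_opp cf_add.
Proof. by move=> f; apply/continuousEP => x /=; rewrite [LHS]addNr. Qed.
HB.instance Definition _ := GRing.isZmodule.Build A cf_addA cf_addC cf_add0 cf_addN.

Lemma cf_mulA : associative cf_mul.
Proof. by move=> f g h; apply/continuousEP => x /=; rewrite [LHS]mulrA. Qed.
Lemma cf_mulC : commutative cf_mul.
Proof. by move=> f g; apply/continuousEP => x /=; rewrite [LHS]mulrC. Qed.
Lemma cf_mul1 : left_id (cf_cst 1) cf_mul.
Proof. by move=> f; apply/continuousEP => x /=; rewrite [LHS]mul1r. Qed.
Lemma cf_mulDl : left_distributive cf_mul cf_add.
Proof. by move=> f g h; apply/continuousEP => x /=; rewrite [LHS]mulrDl. Qed.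
HB.instance Definition _ :=
  GRing.Zmodule_isComPzRing.Build A cf_mulA cf_mulC cf_mul1 cf_mulDl.

Lemma cf_scaleA a b f : cf_scale a (cf_scale b f) = cf_scale (a * b) f.
Proof. by apply/continuousEP => x /=; rewrite [LHS]scalerA. Qed.
Lemma cf_scale1 : left_id 1 cf_scale.
Proof. by move=> f; apply/continuousEP => x /=; rewrite [LHS]scale1r. Qed.
Lemma cf_scaleDr : right_distributive cf_scale +%R.
Proof. by move=> a f g; apply/continuousEP => x /=; rewrite [LHS]scalerDr. Qed.
Lemma cf_scaleDl f : {morph cf_scale^~ f : a b / a + b}.
Proof. by move=> a b; apply/continuousEP => x /=; rewrite [LHS]scalerDl. Qed.
HB.instance Definition _ :=
  GRing.Zmodule_isLmodule.Build R[i] A cf_scaleA cf_scale1 cf_scaleDr cf_scaleDl.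

Definition supnorm f : R := sup (range (fun x => ComplexField.Normc.normc (f x))).

Definition star_isomorphism (T : A -> A) : Prop :=
  [/\ bijective T, linear T, monoid_morphism T
    & forall f, T (cf_adj f) = cf_adj (T f)].

Definition isometric (T : A -> A) : Prop :=
  forall f, supnorm (T f) = supnorm f.

(* A presentation of C*(X) is given by the sequence u substituted for the
   variables. *)
Definition starpoly_eval (u : nat -> A) (p : starpoly) : A :=
  \sum_(t <- p) qi_val t.1 *:
    \prod_(l <- t.2) (if l.2 then cf_adj (u l.1) else u l.1).

Definition rational_vector (u : nat -> A) (n : nat) : A :=
  starpoly_eval u (starpoly_of_code n).

Definition cstar_presented (u : nat -> A) : presented R A :=
  Presented (fun f g => supnorm (f - g)) (rational_vector u).

Definition cstar_presentation (u : nat -> A) : Prop :=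
  dense_points (cstar_presented u).

Definition computable_cstar_presentation (u : nat -> A) : Prop :=
  cstar_presentation u /\
  computable_reals (fun n => supnorm (rational_vector u n)).

Definition evaluative (pr : nat -> nat * nat) (u : nat -> A)
    (P : presented R X) : Prop :=
  computable_map (prod_presented pr (cstar_presented u) P) complex_presented
    (fun fp => fp.1 fp.2).

Definition computably_isometrically_isomorphic (u v : nat -> A) : Prop :=
  exists T : A -> A, [/\ star_isomorphism T, isometric T
    & computable_map (cstar_presented u) (cstar_presented v) T].

End CstarAlgebra.

(* Main.v *)
Require Import Defs.
From mathcomp Require Import all_boot all_order all_algebra.
From mathcomp Require Import all_classical all_reals all_analysis.
From mathcomp Require Import complex.
From mathcomp Require Import zify ring lra.
Local Open Scope classical_set_scope.

(* Existence. The generators are the functions min(q_0, min_l (q_l + N_l d(p_(k_l), .)))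
   with rational q_l and natural N_l; by McShane's extension formula they are
   dense among the real continuous functions. A *-polynomial rho in them has a
   computable constant K such that, on the ball B(p_i; 2^-J), it is within K 2^-J
   of a Gaussian rational computable from i and J. This evaluates rho, and by
   total boundedness also computes its norm.

   Uniqueness. The identity of C*(X) is a computable map between any two
   evaluative presentations u and v. Given a rational vector rho of u, one
   searches for a rational vector rho' of v together with finitely many balls
   covering X, on each of which the two evaluation algorithms, run on a common
   name, return close values after reading only the part of the name shared by
   all the points of the ball. Such a certificate bounds ||rho - rho'||, and
   compactness of X together with the density of v provides one. *)

Set Implicit Arguments.
Unset Strict Implicit.
Unset Printing Implicit Defensive.

(** * Partial recursive functions *)

(** The evaluators given by evaluativity are known to halt only on genuine names, so a search that
    ran them on arbitrary finite data could diverge. Every trial oracle is therefore a finite list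
    followed by a constant index k, and before the run a rational inequality is tested which implies
    that the oracle names p_k and that its list begins a name of every point of B(p_k; 2^-J). If all
    queries fall inside the list, the output is valid on the whole ball. Two tools follow from this:
    a bound on the queries that is itself computable ([rec_use]), and a calculus of computability
    for partial functions, which is why [cmp] carries a domain.

    On the existence side, minima of cones already approximate every real continuous function, so
    the combinations x_m + i x_n of two generators are dense. Conjugation fixes the generators.
    Moduli of Gaussian rationals are square roots, so squared moduli are compared and a single root
    is extracted on a dyadic grid. *)

Fixpoint rec_evals (o : nat -> nat) (gs : seq recfun) (xs ys : seq nat) : Prop :=
  match gs, ys with
  | [::], [::] => True
  | g :: gs', z :: ys' => rec_eval o g xs z /\ rec_evals o gs' xs ys'
  | _, _ => False
  end.

(** The fixpoint inside [rec_eval] is anonymous; this trades it for [rec_evals], on which inductions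
    can be stated. *)
Lemma rec_eval_RComp o f gs xs y :
  rec_eval o (RComp f gs) xs y <->
  exists2 ys, rec_evals o gs xs ys & rec_eval o f ys y.
Proof.
have E ys : (fix evs (gs : seq recfun) (ys : seq nat) : Prop :=
         match gs, ys with
         | [::], [::] => True
         | g :: gs', z :: ys' => rec_eval o g xs z /\ evs gs' ys'
         | _, _ => False
         end) gs ys <-> rec_evals o gs xs ys.
  elim: gs ys => [|g gs IH] [|z ys] //=.
  by split=> -[? /IH].
by split=> -[ys /E ? ?]; exists ys => //; apply/E.
Qed.

(** The generated principle gives no hypothesis for the programs listed in [RComp]; the inner
    induction on the list supplies it. *)
Lemma recfun_ind_nested (P : recfun -> Prop) :
  P RZero -> P RSucc -> (forall i, P (RProj i)) -> P ROracle ->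
  (forall f gs, P f -> (forall g, List.In g gs -> P g) -> P (RComp f gs)) ->
  (forall f g, P f -> P g -> P (RPrec f g)) ->
  (forall f, P f -> P (RMu f)) -> forall c, P c.
Proof.
move=> p0 p1 p2 p3 p4 p5 p6; fix IH 1 => -[||i||f gs|f g|f].
- exact: p0.
- exact: p1.
- exact: p2.
- exact: p3.
- apply: p4; first exact: IH.
  elim: gs => [|g gs IHgs] h /=; first by case.
  by case=> [<- | /IHgs]; [apply: IH | apply].
- by apply: p5; apply: IH.
- by apply: p6; apply: IH.
Qed.

Lemma rec_eval_functional o c xs y y' :
  rec_eval o c xs y -> rec_eval o c xs y' -> y = y'.
Proof.
elim/recfun_ind_nested: c xs y y' => [|||| f gs IHf IHgs| f g IHf IHg| f IHf] xs y y'.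
- by move=> /= -> ->.
- by move=> /= -> ->.
- by move=> i /= -> ->.
- by move=> /= -> ->.
- move=> /rec_eval_RComp [ys Hys Hy] /rec_eval_RComp [zs Hzs Hz].
  suff E : ys = zs by rewrite -E in Hz; apply: IHf Hy Hz.
  elim: gs ys zs IHgs Hys Hzs {Hy Hz} => [|g gs IH] [|a ys] [|b zs] //= IHgs [Ha Hys] [Hb Hzs].
  congr cons; first by apply: (IHgs g) Ha Hb; left.
  by apply: IH => // h Hh; apply: IHgs; right.
- move=> [s [s0 sS ->]] [t [t0 tS ->]].
  (* The two witnessing sequences are constrained only up to the recursion argument, so the
     induction carries this bound. *)
  have: (head 0 xs <= head 0 xs)%N by [].
  elim: {1 3 4}(head 0 xs) => [_|n IH nh]; first exact: IHf s0 t0.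
  apply: IHg (sS _ nh) _; rewrite IH; last exact: ltnW.
  exact: tS.
- move=> [y0 ylt] [z0 zlt].
  case: (ltngtP y y') => // h.
  + by have [z] := zlt _ h; move/(IHf _ _ _ y0).
  + by have [z] := ylt _ h; move/(IHf _ _ _ z0).
Qed.

Lemma rec_comp1 o f g xs a y :
  rec_eval o g xs a -> rec_eval o f [:: a] y -> rec_eval o (RComp f [:: g]) xs y.
Proof. by move=> *; apply/rec_eval_RComp; exists [:: a]. Qed.

Lemma rec_comp2 o f g h xs a b y :
  rec_eval o g xs a -> rec_eval o h xs b -> rec_eval o f [:: a; b] y ->
  rec_eval o (RComp f [:: g; h]) xs y.
Proof. by move=> *; apply/rec_eval_RComp; exists [:: a; b]. Qed.

Lemma rec_comp3 o f g h k xs a b c y :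
  rec_eval o g xs a -> rec_eval o h xs b -> rec_eval o k xs c ->
  rec_eval o f [:: a; b; c] y ->
  rec_eval o (RComp f [:: g; h; k]) xs y.
Proof. by move=> *; apply/rec_eval_RComp; exists [:: a; b; c]. Qed.

(** * Programs for arithmetic and for the pairing function *)

Definition radd := RPrec (RProj 0) (RComp RSucc [:: RProj 1]).
Lemma raddP o a b : rec_eval o radd [:: a; b] (a + b)%N.
Proof. by exists (fun i => i + b)%N; split=> // i _; apply: rec_comp1. Qed.

Definition rmul := RPrec RZero (RComp radd [:: RProj 1; RProj 2]).
Lemma rmulP o a b : rec_eval o rmul [:: a; b] (a * b)%N.
Proof.
exists (fun i => i * b)%N; split=> // i _; apply: rec_comp2; [by [] | by [] |].
by rewrite mulSn addnC; apply: raddP.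
Qed.

Definition rpred := RPrec RZero (RProj 0).
Lemma rpredP o a : rec_eval o rpred [:: a] a.-1.
Proof. by exists predn. Qed.

(** Recursion runs on the first argument, hence the subtrahend comes first. *)
Definition rsubr := RPrec (RProj 0) (RComp rpred [:: RProj 1]).
Lemma rsubrP o a b : rec_eval o rsubr [:: a; b] (b - a)%N.
Proof.
exists (fun i => b - i)%N; split=> //; first by rewrite /= subn0.
by move=> i _; apply: rec_comp1 => //; rewrite subnS; apply: rpredP.
Qed.

Definition rone := RComp RSucc [:: RZero].
Lemma roneP o xs : rec_eval o rone xs 1%N.
Proof. exact: (@rec_comp1 _ RSucc RZero xs 0 1). Qed.

Definition rpow2 := RPrec rone (RComp radd [:: RProj 1; RProj 1]).
Lemma rpow2P o a : rec_eval o rpow2 [:: a] (2 ^ a)%N.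
Proof.
exists (fun i => 2 ^ i)%N; split=> //; first exact: roneP.
move=> i _; apply: rec_comp2 => //.
by rewrite expnS mul2n -addnn; apply: raddP.
Qed.

(** Inverse of [unpair], which factors n + 1 as 2^a (2b + 1). *)
Definition pairn (a b : nat) : nat := (2 ^ a * b.*2.+1).-1.

Definition rpairn := RComp rpred [:: RComp rmul [:: RComp rpow2 [:: RProj 0];
  RComp RSucc [:: RComp radd [:: RProj 1; RProj 1]]]].
Lemma rpairnP o a b : rec_eval o rpairn [:: a; b] (pairn a b).
Proof.
apply: rec_comp1; last exact: rpredP.
apply: rec_comp2; last exact: rmulP.
  by apply: rec_comp1; last exact: rpow2P.
apply: (@rec_comp1 _ _ _ _ b.*2) => //.
by rewrite -addnn; apply: rec_comp2 (raddP _ _ _).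
Qed.

Lemma pairnK a b : unpair (pairn a b) = (a, b).
Proof.
rewrite /unpair /pairn prednK ?muln_gt0 ?expn_gt0 //.
have -> : logn 2 (2 ^ a * b.*2.+1) = a.
  rewrite lognM ?expn_gt0 // pfactorK // (_ : logn 2 _ = 0%N) ?addn0 //.
  by apply/eqP; rewrite lognE /= dvdn2 /= odd_double.
by rewrite mulKn ?expn_gt0 //= uphalf_double.
Qed.

Lemma unpairK n : pairn (unpair n).1 (unpair n).2 = n.
Proof.
rewrite /unpair /pairn /=.
set a := logn 2 n.+1; set m := (n.+1 %/ 2 ^ a)%N.
have En : n.+1 = (2 ^ a * m)%N by rewrite mulnC divnK // pfactor_dvdnn.
have om : odd m.
  have : ~~ (2 ^ a.+1 %| n.+1)%N by rewrite pfactor_dvdn // ltnn.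
  rewrite En expnSr dvdn_pmul2l ?expn_gt0 // dvdn2 negbK //.
by rewrite -[m./2.*2.+1]/(true + _)%N -om odd_double_half -En.
Qed.

(** The distance |a - b|, used as an equality test: it vanishes exactly when a = b. *)
Definition rdist := RComp radd [:: RComp rsubr [:: RProj 0; RProj 1];
                                   RComp rsubr [:: RProj 1; RProj 0]].
Lemma rdistP o a b : rec_eval o rdist [:: a; b] ((b - a) + (a - b))%N.
Proof. by apply: rec_comp2; last exact: raddP; apply: rec_comp2; try exact: rsubrP. Qed.

(** A bounded existential quantifier written as a product: it is zero iff [pairn a b = n] for some b
    < k. *)
Definition rdist_prod := RPrec rone (RComp rmul [:: RProj 1;
  RComp rdist [:: RComp rpairn [:: RProj 2; RProj 0]; RProj 3]]).
Lemma rdist_prodP o k a n : rec_eval o rdist_prod [:: k; a; n]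
  (\prod_(b < k) ((n - pairn a b) + (pairn a b - n)))%N.
Proof.
exists (fun k => \prod_(b < k) ((n - pairn a b) + (pairn a b - n)))%N; split=> //.
  by rewrite big_ord0; apply: roneP.
move=> i _; rewrite big_ord_recr.
apply: rec_comp2; [by []| | exact: rmulP].
apply: rec_comp2; [|by []|exact: rdistP].
by apply: rec_comp2; last exact: rpairnP.
Qed.

Lemma dist_eq0 a b : ((b - a) + (a - b) == 0)%N = (a == b).
Proof. by apply/eqP/eqP; lia. Qed.

(** The components are found by search: the least a such that some b at most n pairs with it to n.
    The bound on b is [snd_unpair_leq]. *)
Definition runfst := RMu (RComp rdist_prod [:: RComp RSucc [:: RProj 1]; RProj 0; RProj 1]).
Lemma snd_unpair_leq n : ((unpair n).2 <= n)%N.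
Proof.
rewrite -{2}(unpairK n) /pairn -ltnS prednK ?muln_gt0 ?expn_gt0 //.
by apply: leq_trans (leq_pmull _ _); rewrite ?expn_gt0 // ltnS -addnn leq_addr.
Qed.
Lemma runfstP o n : rec_eval o runfst [:: n] (unpair n).1.
Proof.
have E a : rec_eval o (RComp rdist_prod [:: RComp RSucc [:: RProj 1]; RProj 0; RProj 1]) [:: a; n]
   (\prod_(b < n.+1) ((n - pairn a b) + (pairn a b - n)))%N.
  by apply: rec_comp3; last exact: rdist_prodP; [apply: rec_comp1| |].
split.
  have := E (unpair n).1.
  rewrite (bigD1 (Ordinal (snd_unpair_leq n : ((unpair n).2 < n.+1)%N))) //=.
  by rewrite unpairK subnn.
move=> m mlt.
have := E m; set p := (\prod_(b < _) _)%N => Ep.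
suff p0 : (0 < p)%N by exists p.-1; rewrite prednK.
rewrite prodn_gt0 // => b; rewrite lt0n dist_eq0; apply/eqP => h.
by move: mlt; rewrite -h pairnK ltnn.
Qed.

Definition runsnd := RMu (RComp rdist [:: RComp rpairn [:: RComp runfst [:: RProj 1]; RProj 0];
  RProj 1]).
Lemma runsndP o n : rec_eval o runsnd [:: n] (unpair n).2.
Proof.
have E b : rec_eval o (RComp rdist [:: RComp rpairn [:: RComp runfst [:: RProj 1]; RProj 0];
  RProj 1]) [:: b; n]
   ((n - pairn (unpair n).1 b) + (pairn (unpair n).1 b - n))%N.
  apply: rec_comp2; last exact: rdistP; last by [].
  apply: rec_comp2; last exact: rpairnP; last by [].
  by apply: rec_comp1; last exact: runfstP.
split; first by have := E (unpair n).2; rewrite unpairK subnn.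
move=> m mlt; have := E m; set p := (_ + _)%N => Ep.
suff p0 : (0 < p)%N by exists p.-1; rewrite prednK.
rewrite lt0n dist_eq0; apply/eqP => h.
have h2 : (unpair n).2 = m by rewrite -h pairnK.
by rewrite h2 ltnn in mlt.
Qed.

Lemma runfst_pairn o a b : rec_eval o runfst [:: pairn a b] a.
Proof. by have := runfstP o (pairn a b); rewrite pairnK. Qed.

Lemma runsnd_pairn o a b : rec_eval o runsnd [:: pairn a b] b.
Proof. by have := runsndP o (pairn a b); rewrite pairnK. Qed.

(** * Computable maps between encoded types *)

Class encodable (A : Type) := ecode : A -> nat.
#[global] Instance encodable_nat : encodable nat := fun n => n.
#[global] Instance encodable_bool : encodable bool := fun b => nat_of_bool b.
#[global] Instance encodable_prod A B `{encodable A, encodable B} : encodable (A * B) :=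
  fun z => pairn (ecode z.1) (ecode z.2).
#[global] Instance encodable_seq : encodable (seq nat) := CodeSeq.code.

(* [f o] is computed from the oracle [o], uniformly in [o], wherever [D o] holds. *)
Definition cmp (A B : Type) `{encodable A, encodable B}
    (D : (nat -> nat) -> A -> Prop) (f : (nat -> nat) -> A -> B) : Prop :=
  exists c, forall o a, D o a -> rec_eval o c [:: ecode a] (ecode (f o a)).

Section Cmp.
Context {A : Type} `{encodable A}.
Implicit Type D : (nat -> nat) -> A -> Prop.

Lemma cmp_sub (B : Type) `{encodable B} D D' (f : (nat -> nat) -> A -> B) :
  cmp D' f -> (forall o a, D o a -> D' o a) -> cmp D f.
Proof. by move=> [c hc] s; exists c => o a /s/hc. Qed.

Lemma cmp_ext (B : Type) `{encodable B} D (f g : (nat -> nat) -> A -> B) :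
  cmp D g -> (forall o a, D o a -> f o a = g o a) -> cmp D f.
Proof. by move=> [c hc] s; exists c => o a oa; rewrite s //; apply: hc. Qed.

Lemma cmp_comp (B C : Type) `{encodable B, encodable C} D E
    (f : (nat -> nat) -> A -> B) (g : (nat -> nat) -> B -> C) :
  cmp E g -> cmp D f -> (forall o a, D o a -> E o (f o a)) ->
  cmp D (fun o a => g o (f o a)).
Proof.
move=> [c hc] [d hd] s; exists (RComp c [:: d]) => o a oa.
by apply: rec_comp1; [apply: hd | apply/hc/s].
Qed.

Lemma cmp_app (B C : Type) `{encodable B, encodable C} D (g : B -> C)
    (f : (nat -> nat) -> A -> B) :
  cmp (fun _ _ => True) (fun _ => g) -> cmp D f -> cmp D (fun o a => g (f o a)).
Proof. by move=> hg hf; apply: (cmp_comp hg hf). Qed.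

Lemma cmp_code (B C : Type) `{encodable B, encodable C} D (g : B -> C)
    (f : (nat -> nat) -> A -> B) c :
  (forall o b, rec_eval o c [:: ecode b] (ecode (g b))) -> cmp D f ->
  cmp D (fun o a => g (f o a)).
Proof. by move=> hg hf; apply: cmp_app hf; exists c => o b _; apply: hg. Qed.

Lemma cmp_id D : cmp D (fun _ a => a).
Proof. by exists (RProj 0). Qed.

Lemma cmp_cst (B : Type) (eB : encodable B) D (b : B) : cmp D (fun _ _ => b).
Proof.
rewrite /cmp; elim: (ecode b) => [|n [c hc]]; first by exists RZero.
exists (RComp RSucc [:: c]) => o a oa; apply: (rec_comp1 (hc o a oa)).
exact: erefl.
Qed.

Lemma cmp_pair (B C : Type) `{encodable B, encodable C} D
    (f : (nat -> nat) -> A -> B) (g : (nat -> nat) -> A -> C) :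
  cmp D f -> cmp D g -> cmp D (fun o a => (f o a, g o a)).
Proof.
move=> [c hc] [d hd]; exists (RComp rpairn [:: c; d]) => o a oa.
by apply: rec_comp2; [apply: hc | apply: hd | apply: rpairnP].
Qed.

Lemma cmp_fst (B C : Type) `{encodable B, encodable C} D
    (f : (nat -> nat) -> A -> B * C) : cmp D f -> cmp D (fun o a => (f o a).1).
Proof.
apply: (@cmp_code _ _ _ _ _ fst _ runfst) => o [b c].
exact: runfst_pairn.
Qed.

Lemma cmp_snd (B C : Type) `{encodable B, encodable C} D
    (f : (nat -> nat) -> A -> B * C) : cmp D f -> cmp D (fun o a => (f o a).2).
Proof.
apply: (@cmp_code _ _ _ _ _ snd _ runsnd) => o [b c].
exact: runsnd_pairn.
Qed.

Lemma cmp_oracle D (f : (nat -> nat) -> A -> nat) :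
  cmp D f -> cmp D (fun o a => o (f o a)).
Proof.
move=> [c hc]; exists (RComp ROracle [:: c]) => o a oa.
by apply: (@rec_comp1 _ _ _ _ (f o a)) => //; apply: hc.
Qed.

Lemma cmp_succ D (f : (nat -> nat) -> A -> nat) :
  cmp D f -> cmp D (fun o a => (f o a).+1).
Proof. by apply: (@cmp_code _ _ _ _ _ succn _ RSucc). Qed.

Lemma cmp_pred D (f : (nat -> nat) -> A -> nat) :
  cmp D f -> cmp D (fun o a => (f o a).-1).
Proof. by apply: (@cmp_code _ _ _ _ _ predn _ rpred) => o b; apply: rpredP. Qed.

Lemma cmp_pow2 D (f : (nat -> nat) -> A -> nat) :
  cmp D f -> cmp D (fun o a => 2 ^ (f o a))%N.
Proof. by apply: (@cmp_code _ _ _ _ _ (expn 2) _ rpow2) => o b; apply: rpow2P. Qed.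

Lemma cmp_code2 D (f g : (nat -> nat) -> A -> nat) (h : nat -> nat -> nat) c :
  (forall o a b, rec_eval o c [:: a; b] (h a b)) ->
  cmp D f -> cmp D g -> cmp D (fun o a => h (f o a) (g o a)).
Proof.
move=> hh [d hd] [e he]; exists (RComp c [:: d; e]) => o a oa.
by apply: rec_comp2 (hd _ _ oa) (he _ _ oa) (hh _ _ _).
Qed.

Lemma cmp_add D (f g : (nat -> nat) -> A -> nat) :
  cmp D f -> cmp D g -> cmp D (fun o a => f o a + g o a)%N.
Proof. exact: (cmp_code2 raddP). Qed.

Lemma cmp_mul D (f g : (nat -> nat) -> A -> nat) :
  cmp D f -> cmp D g -> cmp D (fun o a => f o a * g o a)%N.
Proof. exact: (cmp_code2 rmulP). Qed.

Lemma cmp_sub_nat D (f g : (nat -> nat) -> A -> nat) :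
  cmp D f -> cmp D g -> cmp D (fun o a => f o a - g o a)%N.
Proof. by move=> hf hg; apply: (cmp_code2 rsubrP hg hf). Qed.

Lemma cmp_pairn D (f g : (nat -> nat) -> A -> nat) :
  cmp D f -> cmp D g -> cmp D (fun o a => pairn (f o a) (g o a)).
Proof. exact: (cmp_code2 rpairnP). Qed.

Lemma cmp_unpair D (f : (nat -> nat) -> A -> nat) :
  cmp D f -> cmp D (fun o a => unpair (f o a)).
Proof.
apply: (@cmp_code _ _ _ _ _ unpair _ (RProj 0)) => o n.
exact: unpairK.
Qed.

(** The step has to be computable only on the values that really occur in the recursion (third
    component of the domain); this allows partial programs as steps. *)
Lemma cmp_prec (B : Type) `{encodable B} D (n : (nat -> nat) -> A -> nat)
    (s : (nat -> nat) -> A -> nat -> B)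
    (t : (nat -> nat) -> A * (nat * B) -> B) :
  cmp D n -> cmp D (fun o a => s o a 0%N) ->
  cmp (fun o z => [/\ D o z.1, (z.2.1 < n o z.1)%N & z.2.2 = s o z.1 z.2.1]) t ->
  (forall o a k, D o a -> (k < n o a)%N -> s o a k.+1 = t o (a, (k, s o a k))) ->
  cmp D (fun o a => s o a (n o a)).
Proof.
move=> [cn hn] [cb hb] [ct ht] hs.
exists (RComp (RPrec cb (RComp ct [:: RComp rpairn [:: RProj 2;
   RComp rpairn [:: RProj 0; RProj 1]]])) [:: cn; RProj 0]) => o a oa.
apply: rec_comp2 (hn _ _ oa) _ _ => //.
exists (fun k => ecode (s o a k)); split=> //; first exact: hb.
move=> k kn; rewrite hs //; apply: rec_comp1; last exact: ht.
by apply: rec_comp2; [|apply: rec_comp2; [| |apply: rpairnP]|apply: rpairnP].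
Qed.

End Cmp.

Section CmpArith.
Context {A : Type} `{encodable A}.
Implicit Type D : (nat -> nat) -> A -> Prop.

Lemma cmp_iteri (B : Type) `{encodable B} D (n : (nat -> nat) -> A -> nat)
    (b : (nat -> nat) -> A -> B) (t : (nat -> nat) -> A -> nat -> B -> B) :
  cmp D n -> cmp D b ->
  cmp (fun o (z : A * (nat * B)) => D o z.1) (fun o z => t o z.1 z.2.1 z.2.2) ->
  cmp D (fun o a => iteri (n o a) (t o a) (b o a)).
Proof.
move=> hn hb ht.
apply: (@cmp_prec _ _ _ _ _ n (fun o a k => iteri k (t o a) (b o a))
   (fun o z => t o z.1 z.2.1 z.2.2)) => //.
by apply: cmp_sub ht _ => o z [].
Qed.

End CmpArith.

Section CmpLogic.
Context {A : Type} `{encodable A}.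
Implicit Type D : (nat -> nat) -> A -> Prop.

Lemma cmp_eq0 D (f : (nat -> nat) -> A -> nat) :
  cmp D f -> cmp D (fun o a => f o a == 0%N).
Proof.
move=> hf.
apply: (@cmp_ext _ _ bool _ _ _ (fun o a => iteri (f o a) (fun _ _ => false) true)).
  by apply: cmp_iteri => //; apply: cmp_cst.
by move=> o a _; case: (f o a).
Qed.

Lemma cmp_eqn D (f g : (nat -> nat) -> A -> nat) :
  cmp D f -> cmp D g -> cmp D (fun o a => f o a == g o a).
Proof.
move=> hf hg.
apply: (@cmp_ext _ _ bool _ _ _ (fun o a => (f o a - g o a) + (g o a - f o a) == 0)%N).
  by apply: cmp_eq0; apply: cmp_add; apply: cmp_sub_nat.
by move=> o a _; apply/eqP/eqP; lia.
Qed.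

Lemma cmp_leq D (f g : (nat -> nat) -> A -> nat) :
  cmp D f -> cmp D g -> cmp D (fun o a => f o a <= g o a)%N.
Proof. by move=> hf hg; apply: cmp_eq0; apply: cmp_sub_nat. Qed.

(** Each branch is assumed computable only where it is selected, so the program must never run the
    other one. *)
Lemma cmp_if (B : Type) `{encodable B} D (b : (nat -> nat) -> A -> bool)
    (f g : (nat -> nat) -> A -> B) :
  cmp D b -> cmp (fun o a => D o a /\ b o a) f ->
  cmp (fun o a => D o a /\ ~~ b o a) g ->
  cmp D (fun o a => if b o a then f o a else g o a).
Proof.
move=> hb [cf hf] [cg hg].
have [c hc] : cmp D (fun o a => 1 - b o a)%N.
  by apply: cmp_sub_nat; [apply: cmp_cst | case: hb => cb hcb; exists cb].
case: hb => cb hb.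
(* The truth value serves as a recursion argument: at 0 the recursion returns 0 without running its
   step, at 1 it runs the branch once. The two results are added. *)
exists (RComp radd [:: RComp (RPrec RZero (RComp cf [:: RProj 2])) [:: cb; RProj 0];
                       RComp (RPrec RZero (RComp cg [:: RProj 2])) [:: c; RProj 0]]) => o a oa.
have {hb hc} := conj (hb _ _ oa) (hc _ _ oa).
case E: (b o a) => -[hb hc].
  apply: (@rec_comp2 _ _ _ _ _ (ecode (f o a)) 0).
  - apply: rec_comp2 hb _ _ => //.
    exists (fun k => if k is 0%N then 0%N else ecode (f o a)); split=> // -[_|//].
    by apply: rec_comp1; last exact: hf.
  - by apply: rec_comp2 hc _ _ => //; exists (fun=> 0)%N.
  - by rewrite -[X in rec_eval _ _ _ X]addn0; apply: raddP.
apply: (@rec_comp2 _ _ _ _ _ 0 (ecode (g o a))).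
- by apply: rec_comp2 hb _ _ => //; exists (fun=> 0)%N.
- apply: rec_comp2 hc _ _ => //.
  exists (fun k => if k is 0%N then 0%N else ecode (g o a)); split=> // -[_|//].
  by apply: rec_comp1; last by apply: hg; split=> //; rewrite E.
- exact: raddP.
Qed.

Lemma cmp_negb D (b : (nat -> nat) -> A -> bool) :
  cmp D b -> cmp D (fun o a => ~~ b o a).
Proof. by move=> hb; apply: cmp_if => //; apply: cmp_cst. Qed.

(** Short-circuit conjunction: a decidable first test may guard a partial second one. *)
Lemma cmp_andb D (b c : (nat -> nat) -> A -> bool) :
  cmp D b -> cmp (fun o a => D o a /\ b o a) c -> cmp D (fun o a => b o a && c o a).
Proof. by move=> hb hc; apply: cmp_if => //; apply: cmp_cst. Qed.

End CmpLogic.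

Section CmpMu.
Context {A : Type} `{encodable A}.
Implicit Type D : (nat -> nat) -> A -> Prop.

(** The test must be decidable only up to the least witness. It is negated in the proof because
    [RMu] searches for a zero. *)
Lemma cmp_mu D (f : (nat -> nat) -> A -> nat) (p : (nat -> nat) -> A -> nat -> bool) :
  cmp (fun o (z : A * nat) => D o z.1 /\ (z.2 <= f o z.1)%N) (fun o z => p o z.1 z.2) ->
  (forall o a, D o a -> p o a (f o a)) ->
  (forall o a m, D o a -> (m < f o a)%N -> ~~ p o a m) ->
  cmp D f.
Proof.
move=> /cmp_negb [c hc] pf pn.
exists (RMu (RComp c [:: RComp rpairn [:: RProj 1; RProj 0]])) => o a oa.
have E m : (m <= f o a)%N -> rec_eval o (RComp c [:: RComp rpairn [:: RProj 1; RProj 0]])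
    [:: m; ecode a] (~~ p o a m).
  move=> mf; apply: rec_comp1; last by apply: (hc o (a, m)).
  by apply: rec_comp2; last exact: rpairnP.
split; first by have := E _ (leqnn _); rewrite pf.
by move=> m mf; exists 0%N; have := E _ (ltnW mf); rewrite pn.
Qed.

End CmpMu.

(* Automation for computability goals *)
Create HintDb cmp.
#[global] Hint Constants Opaque : cmp.
#[global] Hint Resolve cmp_id cmp_cst cmp_pair cmp_oracle cmp_succ cmp_pred
  cmp_pow2 cmp_add cmp_mul cmp_sub_nat cmp_pairn cmp_unpair cmp_eq0 cmp_eqn cmp_leq
  cmp_if cmp_negb cmp_andb : cmp.
#[global] Hint Extern 1 (cmp _ _) => lazymatch goal with
  | |- cmp _ (fun o a => fst (@?e o a)) => apply (@cmp_fst _ _ _ _ _ _ _ e)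
  | |- cmp _ (fun o a => snd (@?e o a)) => apply (@cmp_snd _ _ _ _ _ _ _ e)
  | |- cmp _ (fun o a => iteri _ _ _) => apply cmp_iteri; cbv beta
  | |- cmp _ (fun o a => iteri (@?e o a) (@?f o a) (@?g o a)) => apply cmp_iteri; cbv beta
  end : cmp.

Ltac cmp_auto := solve [auto 40 with cmp nocore].

Section CmpMore.
Context {A : Type} `{encodable A}.
Implicit Type D : (nat -> nat) -> A -> Prop.

Lemma cmp_odd D (f : (nat -> nat) -> A -> nat) :
  cmp D f -> cmp D (fun o a => odd (f o a)).
Proof.
move=> hf; apply: (@cmp_ext _ _ bool _ _ _ (fun o a => iteri (f o a) (fun _ b => ~~ b) false)).
  cmp_auto.
by move=> o a _; elim: (f o a) => //= n ->.
Qed.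
End CmpMore.
#[global] Hint Resolve cmp_odd : cmp.

(** * Codes of finite sequences *)

Section CmpCode.
Context {A : Type} `{encodable A}.
Implicit Type D : (nat -> nat) -> A -> Prop.

Lemma cmp_half D (f : (nat -> nat) -> A -> nat) :
  cmp D f -> cmp D (fun o a => (f o a)./2).
Proof.
move=> hf; apply: (@cmp_ext _ _ nat _ _ _ (fun o a => iteri (f o a)
  (fun k m => (if odd k then 1 else 0) + m)%N 0%N)).
  cmp_auto.
by move=> o a _; elim: (f o a) => //= n <-; rewrite uphalf_half.
Qed.

(** A list is encoded by [CodeSeq.code], so on the level of codes decoding is the identity. *)
Lemma cmp_decode D (f : (nat -> nat) -> A -> nat) :
  cmp D f -> cmp D (fun o a => CodeSeq.decode (f o a)).
Proof. case=> c hc; exists c => o a /hc.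
by rewrite -{1}[f o a]CodeSeq.decodeK. Qed.

Lemma cmp_size_bound D (f : (nat -> nat) -> A -> seq nat) :
  cmp D f -> cmp D (fun o a => CodeSeq.code (f o a)).
Proof. by case=> c hc; exists c. Qed.

Lemma codeseq_cons n s : CodeSeq.code (n :: s) = (pairn n (CodeSeq.code s)).+1.
Proof. by rewrite /pairn prednK // muln_gt0 expn_gt0. Qed.
#[local] Hint Resolve cmp_size_bound : cmp.

Lemma cmp_cons D (f : (nat -> nat) -> A -> nat) (g : (nat -> nat) -> A -> seq nat) :
  cmp D f -> cmp D g -> cmp D (fun o a => f o a :: g o a).
Proof.
move=> hf hg.
have [c hc] : cmp D (fun o a => (pairn (f o a) (CodeSeq.code (g o a))).+1) by cmp_auto.
by exists c => o a oa; rewrite [X in rec_eval _ _ _ X]codeseq_cons; apply: hc.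
Qed.

(** The empty list is covered too: [unpair 0] is (0, 0), which agrees with the default head and with
    the code of the empty tail. *)
Lemma code_head s : head 0%N s = (unpair (CodeSeq.code s).-1).1.
Proof. by case: s => [|n s]; rewrite ?codeseq_cons ?pairnK. Qed.

Lemma code_behead s : CodeSeq.code (behead s) = (unpair (CodeSeq.code s).-1).2.
Proof. by case: s => [|n s]; rewrite ?codeseq_cons ?pairnK. Qed.

Lemma cmp_head D (f : (nat -> nat) -> A -> seq nat) :
  cmp D f -> cmp D (fun o a => head 0%N (f o a)).
Proof.
move=> hf; apply: (@cmp_ext _ _ nat _ _ _ (fun o a => (unpair (CodeSeq.code (f o a)).-1).1)).
  by cmp_auto.
by move=> o a _; rewrite code_head.
Qed.

Lemma cmp_behead D (f : (nat -> nat) -> A -> seq nat) :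
  cmp D f -> cmp D (fun o a => behead (f o a)).
Proof.
move=> hf; have [c hc] : cmp D (fun o a => (unpair (CodeSeq.code (f o a)).-1).2) by cmp_auto.
by exists c => o a oa; rewrite [X in rec_eval _ _ _ X]code_behead; apply: hc.
Qed.

End CmpCode.
#[global] Hint Resolve cmp_half cmp_decode cmp_size_bound cmp_cons cmp_head cmp_behead : cmp.

Section CmpSeq.
Context {A : Type} `{encodable A}.
Implicit Type D : (nat -> nat) -> A -> Prop.

Lemma iteri_behead (B : Type) n (s : seq B) : iteri n (fun _ => behead) s = drop n s.
Proof. by elim: n => [|n IH] /=; rewrite ?drop0 // IH -drop1 drop_drop. Qed.

Lemma cmp_nth D (n : (nat -> nat) -> A -> nat) (f : (nat -> nat) -> A -> seq nat) :
  cmp D n -> cmp D f -> cmp D (fun o a => nth 0%N (f o a) (n o a)).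
Proof.
move=> hn hf.
apply: (@cmp_ext _ _ nat _ _ _ (fun o a => head 0%N (iteri (n o a) (fun _ => behead) (f o a)))).
  by cmp_auto.
by move=> o a _; rewrite iteri_behead -nth0 nth_drop addn0.
Qed.

Lemma size_code s : (size s <= CodeSeq.code s)%N.
Proof.
elim: s => //= n s IH; apply: leq_ltn_trans IH _.
by rewrite (leq_trans _ (leq_pmull _ _)) ?expn_gt0 // ltnS -addnn leq_addr.
Qed.

Lemma cmp_foldl (B : Type) `{encodable B} D (t : (nat -> nat) -> A -> B -> nat -> B)
    (b : (nat -> nat) -> A -> B) (f : (nat -> nat) -> A -> seq nat) :
  cmp D f -> cmp D b ->
  cmp (fun o (z : A * (B * nat)) => D o z.1) (fun o z => t o z.1 z.2.1 z.2.2) ->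
  cmp D (fun o a => foldl (t o a) (b o a) (f o a)).
Proof.
move=> hf hb ht.
(* The state is the unread list with the accumulator. The step is iterated as often as the code of
   the list says, at least its length; once the list is empty the state no longer changes. *)
pose st o a (z : seq nat * B) :=
  if CodeSeq.code z.1 == 0%N then z else (behead z.1, t o a z.2 (head 0%N z.1)).
have E o a n s y : (size s <= n)%N ->
    (iteri n (fun _ => st o a) (s, y)).2 = foldl (t o a) y s.
  move=> sn.
  suff -> : iteri n (fun _ => st o a) (s, y) = (drop n s, foldl (t o a) y (take n s)).
    by rewrite /= take_oversize.
  elim: n {sn} => [|n IH] /=; first by rewrite drop0 take0.
  rewrite IH /st /=.
  have [ns|sn] := ltnP n (size s).
    rewrite (drop_nth 0%N ns) codeseq_cons /=.
    by rewrite (take_nth 0%N ns) foldl_rcons.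
  by rewrite !drop_oversize ?take_oversize // ltnW.
apply: (@cmp_ext _ _ B _ _ _ (fun o a =>
   (iteri (CodeSeq.code (f o a)) (fun _ => st o a) (f o a, b o a)).2)).
  apply: (@cmp_snd _ _ _ _ _ _ _ (fun o a => iteri (CodeSeq.code (f o a))
    (fun _ => st o a) (f o a, b o a))).
  apply: cmp_iteri; [cmp_auto|cmp_auto|].
  apply: cmp_if; [cmp_auto|cmp_auto|].
  apply: cmp_pair; first by cmp_auto.
  apply: (@cmp_comp _ _ (A * (B * nat)) B _ _ _ _
    (fun o (z : A * (nat * (seq nat * B))) => (z.1, (z.2.2.2, head 0%N z.2.2.1)))
    (fun o z => t o z.1 z.2.1 z.2.2)); first exact: ht.
    by cmp_auto.
  by move=> o z [].
by move=> o a _; rewrite E // size_code.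
Qed.

End CmpSeq.

#[global] Hint Resolve cmp_nth : cmp.
#[global] Hint Extern 1 (cmp _ _) => lazymatch goal with
  | |- cmp _ (fun o a => foldl _ _ _) => apply cmp_foldl; cbv beta
  | |- cmp _ (fun o a => foldl (@?e o a) (@?f o a) (@?g o a)) => apply cmp_foldl; cbv beta
  end : cmp.

Section CmpPred.
Context {A : Type} `{encodable A}.
Implicit Type D : (nat -> nat) -> A -> Prop.

Lemma cmp_all D (p : (nat -> nat) -> A -> nat -> bool) (f : (nat -> nat) -> A -> seq nat) :
  cmp D f -> cmp (fun o (z : A * nat) => D o z.1) (fun o z => p o z.1 z.2) ->
  cmp D (fun o a => all (p o a) (f o a)).
Proof.
move=> hf hp.
apply: (@cmp_ext _ _ bool _ _ _ (fun o a => foldl (fun b n => b && p o a n) true (f o a))).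
  apply: cmp_foldl => //; first by cmp_auto.
  apply: cmp_andb; first by cmp_auto.
  apply: (@cmp_comp _ _ (A * nat) bool _ _ _ _
    (fun o (z : A * (bool * nat)) => (z.1, z.2.2)) (fun o z => p o z.1 z.2));
      [exact: hp|cmp_auto|].
  by move=> o z [].
move=> o a _; rewrite -[LHS]andTb.
elim: (f o a) true => [|n s IH] b //=; first by rewrite andbT.
by rewrite andbA IH.
Qed.

Lemma cmp_has D (p : (nat -> nat) -> A -> nat -> bool) (f : (nat -> nat) -> A -> seq nat) :
  cmp D f -> cmp (fun o (z : A * nat) => D o z.1) (fun o z => p o z.1 z.2) ->
  cmp D (fun o a => has (p o a) (f o a)).
Proof.
move=> hf hp.
apply: (@cmp_ext _ _ bool _ _ _ (fun o a => ~~ all (fun n => ~~ p o a n) (f o a))).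
  by apply: cmp_negb; apply: cmp_all => //; apply: cmp_negb.
by move=> o a _; rewrite -has_predC; apply: eq_has => n /=; rewrite negbK.
Qed.

End CmpPred.
#[global] Hint Extern 1 (cmp _ _) => lazymatch goal with
  | |- cmp _ (fun o a => all _ _) => apply cmp_all; cbv beta
  | |- cmp _ (fun o a => all (@?e o a) (@?f o a)) => apply cmp_all; cbv beta
  | |- cmp _ (fun o a => has _ _) => apply cmp_has; cbv beta
  | |- cmp _ (fun o a => has (@?e o a) (@?f o a)) => apply cmp_has; cbv beta
  end : cmp.

(** * Oracle use and oracle substitution *)

Definition rec_dom (o : nat -> nat) (c : recfun) (xs : seq nat) : Prop :=
  exists y, rec_eval o c xs y.

Definition rec_val (o : nat -> nat) (c : recfun) (xs : seq nat) : nat :=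
  xget 0%N [set y | rec_eval o c xs y]%classic.

Lemma rec_valP o c xs : rec_dom o c xs -> rec_eval o c xs (rec_val o c xs).
Proof. by case=> y hy; apply: (@xgetPex _ 0%N [set y | rec_eval o c xs y]%classic); exists y. Qed.

Lemma rec_valE o c xs y : rec_eval o c xs y -> rec_val o c xs = y.
Proof. by move=> h; apply: (rec_eval_functional _ h); apply: rec_valP; exists y. Qed.

Lemma rec_evals_map o gs xs ys : rec_evals o gs xs ys ->
  ys = [seq rec_val o g xs | g <- gs] /\ forall g, List.In g gs -> rec_dom o g xs.
Proof.
elim: gs ys => [|g gs IH] [|y ys] //= [hy /IH [-> hgs]].
split; first by rewrite (rec_valE hy).
by move=> h [<-|/hgs //]; exists y.
Qed.

Lemma rec_dom_comp o f gs xs : rec_dom o (RComp f gs) xs ->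
  [/\ forall g, List.In g gs -> rec_dom o g xs,
      rec_dom o f [seq rec_val o g xs | g <- gs] &
      rec_val o (RComp f gs) xs = rec_val o f [seq rec_val o g xs | g <- gs]].
Proof.
case=> y h; have /rec_eval_RComp [ys /rec_evals_map [-> hgs] hy] := h.
by split=> //; [exists y | rewrite (rec_valE h) (rec_valE hy)].
Qed.

(** The intermediate values of a halting recursion are values of the same program at smaller
    arguments. This canonical sequence replaces the one hidden in the existential of [rec_eval]. *)
Lemma rec_dom_prec o f g xs : rec_dom o (RPrec f g) xs ->
  let s i := rec_val o (RPrec f g) (i :: behead xs) in
  [/\ rec_dom o f (behead xs), s 0%N = rec_val o f (behead xs),
      forall i, (i < head 0%N xs)%N -> rec_dom o g [:: i, s i & behead xs] /\
         s i.+1 = rec_val o g [:: i, s i & behead xs]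
      & rec_val o (RPrec f g) xs = s (head 0%N xs)].
Proof.
case=> y [t [t0 tS ty]] s.
have st i : (i <= head 0%N xs)%N -> s i = t i.
  move=> ih; apply: rec_valE; exists t; split=> // j jh.
  by apply: tS; apply: leq_trans ih.
split.
- by exists (t 0%N).
- by rewrite st // (rec_valE t0).
- move=> i ih; rewrite !st //; last exact: ltnW.
  by split; [exists (t i.+1); apply: tS | rewrite (rec_valE (tS _ ih))].
- by rewrite st //; apply: rec_valE; exists t.
Qed.

Lemma rec_dom_mu o f xs : rec_dom o (RMu f) xs ->
  [/\ rec_eval o f (rec_val o (RMu f) xs :: xs) 0%N,
      forall m, (m < rec_val o (RMu f) xs)%N -> (0 < rec_val o f (m :: xs))%N
    & forall m, (m <= rec_val o (RMu f) xs)%N -> rec_dom o f (m :: xs)].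
Proof.
move=> /rec_valP [h0 hlt]; split=> // m.
  by move=> /hlt [z /rec_valE ->].
by rewrite leq_eqVlt => /orP [/eqP -> | /hlt [z hz]]; [exists 0%N | exists z.+1].
Qed.

(* All oracle queries of the computation are below [rec_use o c xs]; sums are
   used where maxima would suffice. *)
Fixpoint rec_use (o : nat -> nat) (c : recfun) (xs : seq nat) : nat :=
  match c with
  | RZero => 0
  | RSucc => 0
  | RProj _ => 0
  | ROracle => (head 0 xs).+1
  | RComp f gs => rec_use o f [seq rec_val o g xs | g <- gs] +
      foldr (fun g m => rec_use o g xs + m) 0 gs
  | RPrec f g => rec_use o f (behead xs) +
      \sum_(i < head 0 xs)
        rec_use o g [:: nat_of_ord i, rec_val o (RPrec f g) (nat_of_ord i :: behead xs)
          & behead xs]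
  | RMu f => \sum_(m < (rec_val o (RMu f) xs).+1) rec_use o f (nat_of_ord m :: xs)
  end%N.

(** Continuity in the oracle. The use is transferred along with the value, so that it can be
    computed from either of the two oracles. *)
Lemma rec_use_agree o o' c xs : rec_dom o c xs ->
  (forall i, (i < rec_use o c xs)%N -> o' i = o i) ->
  rec_eval o' c xs (rec_val o c xs) /\ rec_use o' c xs = rec_use o c xs.
Proof.
elim/recfun_ind_nested: c xs => [|||| f gs IHf IHgs| f g IHf IHg| f IHf] xs.
- by move=> [y h] _; rewrite (rec_valE h).
- by move=> [y h] _; rewrite (rec_valE h).
- by move=> i [y h] _; rewrite (rec_valE h).
- move=> [y h] E; rewrite (rec_valE h) h; split=> //=.
  by rewrite E.
- move=> d; have [dgs df ->] := rec_dom_comp d => E.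
  have Eg : [seq rec_val o' g xs | g <- gs] = [seq rec_val o g xs | g <- gs] /\
      [/\ rec_evals o' gs xs [seq rec_val o g xs | g <- gs] &
       foldr (fun g m => rec_use o' g xs + m)%N 0%N gs =
       foldr (fun g m => rec_use o g xs + m)%N 0%N gs].
    have {}E i : (i < foldr (fun g m => rec_use o g xs + m) 0 gs)%N -> o' i = o i.
      by move=> h; apply: E => /=; apply: leq_trans h _; apply: leq_addl.
    elim: gs IHgs dgs E {d df} => [|g gs IH] //= IHgs dgs E.
    have [||//|hg ug] := IHgs g _ xs; [by left | by apply: dgs; left | |].
      by move=> i h; apply: E; apply: leq_trans h _; apply: leq_addr.
    have [||| -> [h2 ->]] := IH.
    + by move=> h hi; apply: IHgs; right.
    + by move=> h hi; apply: dgs; right.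
    + by move=> i h; apply: E; apply: leq_trans h _; apply: leq_addl.
    by rewrite (rec_valE hg) ug.
  case: Eg => E1 [E2 E3].
  have [//||h1 h2] := IHf [seq rec_val o g xs | g <- gs].
    by move=> i h; apply: E => /=; apply: leq_trans h _; apply: leq_addr.
  split; last by rewrite /= E1 E3 h2.
  by apply/rec_eval_RComp; exists [seq rec_val o g xs | g <- gs].
- move=> d; have [df s0 sS ->] := rec_dom_prec d => E.
  set s := fun i => rec_val o (RPrec f g) (i :: behead xs).
  have [//||h1 h2] := IHf (behead xs).
    by move=> i h; apply: E => /=; apply: leq_trans h _; apply: leq_addr.
  have G i : (i < head 0%N xs)%N -> rec_eval o' g [:: i, s i & behead xs] (s i.+1) /\
      rec_use o' g [:: i, s i & behead xs] = rec_use o g [:: i, s i & behead xs].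
    move=> ih; have [dg sE] := sS _ ih; rewrite [s i.+1]sE.
    apply: IHg => // j jh; apply: E => /=.
    apply: leq_trans jh _; apply: leq_trans (leq_addl _ _).
    by rewrite (bigD1 (Ordinal ih)) //= leq_addr.
  have V i : (i <= head 0%N xs)%N -> rec_eval o' (RPrec f g) (i :: behead xs) (s i).
    move=> ih; exists s; split=> //=; first by rewrite /s s0.
    by move=> j ji; apply: (G j _).1; apply: leq_trans ih.
  split.
    exists s; split=> //=; first by rewrite /s s0.
    by move=> i /G [].
  rewrite /= h2; congr (_ + _)%N; apply: eq_bigr => -[i ih] _ /=.
  by rewrite (rec_valE (V i (ltnW ih))) (G i ih).2.
- move=> d; have [h0 hpos hd] := rec_dom_mu d => E.
  have G m : (m <= rec_val o (RMu f) xs)%N -> rec_eval o' f (m :: xs) (rec_val o f (m :: xs)) /\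
      rec_use o' f (m :: xs) = rec_use o f (m :: xs).
    move=> mh; apply: IHf; first exact: hd.
    move=> j jh; apply: E; apply: leq_trans jh _ => /=.
    by rewrite (bigD1 (Ordinal (mh : (m < _.+1)%N))) //= leq_addr.
  have H : rec_eval o' (RMu f) xs (rec_val o (RMu f) xs).
    split; first by have := (G _ (leqnn _)).1; rewrite (rec_valE h0).
    move=> m mh; exists (rec_val o f (m :: xs)).-1; rewrite prednK; last exact: hpos.
    exact: (G _ (ltnW mh)).1.
  split=> //=; rewrite (rec_valE H); apply: eq_bigr => -[m mh] _ /=.
  by rewrite (G m _).2.
Qed.

(** * Running a program on a computed family of oracles *)

Section Substitution.
Context {P : Type} `{encodable P}.
Variable O : (nat -> nat) -> P -> nat -> nat.
Hypothesis cmpO : cmp (fun _ _ => True) (fun o (z : P * nat) => O o z.1 z.2).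

Lemma cmp_O (A : Type) `{encodable A} D (f : (nat -> nat) -> A -> P) (g : (nat -> nat)
  -> A -> nat) :
  cmp D f -> cmp D g -> cmp D (fun o a => O o (f o a) (g o a)).
Proof.
by move=> hf hg; apply: (cmp_comp cmpO (f := fun o a => (f o a, g o a))) => //; cmp_auto.
Qed.
Hint Resolve cmp_O : cmp.

Let dom c o (z : P * seq nat) := rec_dom (O o z.1) c z.2.

Lemma cmp_map_val gs :
  (forall g, List.In g gs -> cmp (dom g) (fun o z => rec_val (O o z.1) g z.2)) ->
  cmp (fun o z => forall g, List.In g gs -> dom g o z)
    (fun o z => [seq rec_val (O o z.1) g z.2 | g <- gs]).
Proof.
elim: gs => [|g gs IH] h; first exact: cmp_cst.
apply: cmp_cons.
  by apply: cmp_sub (h g _) _; [left | move=> o z; apply; left].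
apply: cmp_sub (IH _) _; first by move=> k hk; apply: h; right.
by move=> o z hz k hk; apply: hz; right.
Qed.

(** Each oracle query is replaced by a computation of [O]. The translation is built by induction on
    the fixed program [c], one program for each [c], and is claimed only where [c] halts. *)
Lemma cmp_rec_val c : cmp (dom c) (fun o z => rec_val (O o z.1) c z.2).
Proof.
elim/recfun_ind_nested: c => [|||| f gs IHf IHgs| f g IHf IHg| f IHf].
- by apply: cmp_ext (cmp_cst _ _ 0%N) _ => o z [y h]; rewrite (rec_valE h).
- apply: (@cmp_ext _ _ nat _ _ _ (fun o z => (head 0%N z.2).+1)); first by cmp_auto.
  by move=> o z [y h]; rewrite (rec_valE h).
- move=> i; apply: (@cmp_ext _ _ nat _ _ _ (fun o z => nth 0%N z.2 i)); first by cmp_auto.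
  by move=> o z [y h]; rewrite (rec_valE h).
- apply: (@cmp_ext _ _ nat _ _ _ (fun o z => O o z.1 (head 0%N z.2))); first by cmp_auto.
  by move=> o z [y h]; rewrite (rec_valE h).
- apply: (@cmp_ext _ _ nat _ _ _
  (fun o z => rec_val (O o z.1) f [seq rec_val (O o z.1) g z.2 | g <- gs])); last first.
    by move=> o z /rec_dom_comp [].
  apply: (@cmp_comp _ _ (P * seq nat) nat _ _ _ _
    (fun o z => (z.1, [seq rec_val (O o z.1) g z.2 | g <- gs]))
      (fun o z => rec_val (O o z.1) f z.2)).
  + exact: IHf.
  + apply: cmp_pair; first by cmp_auto.
    by apply: cmp_sub (cmp_map_val IHgs) _ => o z /rec_dom_comp [].
  + by move=> o z /rec_dom_comp [].
- apply: (@cmp_ext _ _ nat _ _ _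
  (fun o z => rec_val (O o z.1) (RPrec f g) (head 0%N z.2 :: behead z.2))); last first.
    by move=> o z /rec_dom_prec [].
  apply: (@cmp_prec _ _ nat _ _ (fun o z => head 0%N z.2)
     (fun o z k => rec_val (O o z.1) (RPrec f g) (k :: behead z.2))
     (fun o z => rec_val (O o z.1.1) g [:: z.2.1, z.2.2 & behead z.1.2])).
  + by cmp_auto.
  + apply: (@cmp_ext _ _ nat _ _ _ (fun o z => rec_val (O o z.1) f (behead z.2))); last first.
      by move=> o z /rec_dom_prec [].
    apply: (@cmp_comp _ _ (P * seq nat) nat _ _ _ _
      (fun o z => (z.1, behead z.2)) (fun o z => rec_val (O o z.1) f z.2)).
    - exact: IHf.
    - by cmp_auto.
    - by move=> o z /rec_dom_prec [].
  + apply: (@cmp_comp _ _ (P * seq nat) nat _ _ _ _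
      (fun o z => (z.1.1, [:: z.2.1, z.2.2 & behead z.1.2]))
        (fun o z => rec_val (O o z.1) g z.2)).
    - exact: IHg.
    - by cmp_auto.
    - by move=> o z [/rec_dom_prec [_ _ hS _] /hS [h _]] E; rewrite /dom /= E.
  + by move=> o z k /rec_dom_prec [_ _ hS _] /hS [].
- apply: (@cmp_mu _ _ _ _ (fun o z m => rec_val (O o z.1) f (m :: z.2) == 0%N)).
  + apply: cmp_eq0; apply: (@cmp_comp _ _ (P * seq nat) nat _ _ _ _
      (fun o z => (z.1.1, z.2 :: z.1.2)) (fun o z => rec_val (O o z.1) f z.2)).
    - exact: IHf.
    - by cmp_auto.
    - by move=> o z [/rec_dom_mu [_ _ h] /h].
  + by move=> o z /rec_dom_mu [/rec_valE ->].
  + by move=> o z m /rec_dom_mu [_ h _] /h; case: (rec_val _ _ _).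
Qed.

Lemma cmp_rec_val_app (A : Type) `{encodable A} D c (f : (nat -> nat) -> A -> P)
    (g : (nat -> nat) -> A -> seq nat) :
  cmp D f -> cmp D g -> (forall o a, D o a -> rec_dom (O o (f o a)) c (g o a)) ->
  cmp D (fun o a => rec_val (O o (f o a)) c (g o a)).
Proof.
move=> hf hg hd; apply: (cmp_comp (cmp_rec_val c) (f := fun o a => (f o a, g o a))) => //.
by cmp_auto.
Qed.

Lemma cmp_rec_use c : cmp (dom c) (fun o z => rec_use (O o z.1) c z.2).
Proof.
elim/recfun_ind_nested: c => [|||| f gs IHf IHgs| f g IHf IHg| f IHf] /=.
- exact: cmp_cst.
- exact: cmp_cst.
- by move=> i; exact: cmp_cst.
- by cmp_auto.
- apply: cmp_add.
    apply: (@cmp_comp _ _ (P * seq nat) nat _ _ _ _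
      (fun o z => (z.1, [seq rec_val (O o z.1) g z.2 | g <- gs]))
        (fun o z => rec_use (O o z.1) f z.2)).
    + exact: IHf.
    + apply: cmp_pair; first by cmp_auto.
      apply: cmp_sub (@cmp_map_val gs _) _; last by move=> o z /rec_dom_comp [].
      by move=> g _; apply: cmp_rec_val.
    + by move=> o z /rec_dom_comp [].
  apply: (@cmp_sub _ _ _ _ _ (fun o z => forall g, List.In g gs -> dom g o z)); last first.
    by move=> o z /rec_dom_comp [].
  elim: gs IHgs => [|g gs IH] h /=; first exact: cmp_cst.
  apply: cmp_add.
    by apply: cmp_sub (h g _) _; [left | move=> o z; apply; left].
  apply: cmp_sub (IH _) _; first by move=> k hk; apply: h; right.
  by move=> o z hz k hk; apply: hz; right.
- apply: cmp_add.
    apply: (@cmp_comp _ _ (P * seq nat) nat _ _ _ _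
      (fun o z => (z.1, behead z.2)) (fun o z => rec_use (O o z.1) f z.2)).
    - exact: IHf.
    - by cmp_auto.
    - by move=> o z /rec_dom_prec [].
  pose F o (z : P * seq nat) (i : nat) :=
    rec_use (O o z.1) g [:: i, rec_val (O o z.1) (RPrec f g) (i :: behead z.2) & behead z.2].
  apply: (@cmp_prec _ _ nat _ _ (fun o z => head 0%N z.2)
    (fun o z k => \sum_(i < k) F o z i)%N (fun o z => z.2.2 + F o z.1 z.2.1)%N).
  + by cmp_auto.
  + by apply: cmp_ext (cmp_cst _ _ 0%N) _ => o z _; rewrite big_ord0.
  + apply: cmp_add; first by cmp_auto.
    apply: (@cmp_comp _ _ (P * seq nat) nat _ _ _ _
      (fun o z => (z.1.1, [:: z.2.1, rec_val (O o z.1.1) (RPrec f g) (z.2.1 :: behead z.1.2)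
        & behead z.1.2])) (fun o z => rec_use (O o z.1) g z.2)).
    - exact: IHg.
    - apply: cmp_pair; first by cmp_auto.
      apply: cmp_cons; first by cmp_auto.
      apply: cmp_cons; last by cmp_auto.
      apply: cmp_rec_val_app; [cmp_auto|cmp_auto|].
      (* A sequence witnessing the whole recursion also witnesses it at every smaller recursion
         argument. *)
      move=> o z [[y [s [s0 sS sy]]] /= h _]; exists (s z.2.1); exists s; split=> // i ih.
      by apply: sS; apply: ltn_trans h.
    - by move=> o z [/rec_dom_prec [_ _ hS _] /hS [h _] _].
  + by move=> o z k _ _; rewrite big_ord_recr.
- pose F o (z : P * seq nat) (i : nat) := rec_use (O o z.1) f (i :: z.2).
  apply: (@cmp_prec _ _ nat _ _ (fun o z => (rec_val (O o z.1) (RMu f) z.2).+1)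
    (fun o z k => \sum_(i < k) F o z i)%N (fun o z => z.2.2 + F o z.1 z.2.1)%N).
  + by apply: cmp_succ; apply: cmp_rec_val.
  + by apply: cmp_ext (cmp_cst _ _ 0%N) _ => o z _; rewrite big_ord0.
  + apply: cmp_add; first by cmp_auto.
    apply: (@cmp_comp _ _ (P * seq nat) nat _ _ _ _
      (fun o z => (z.1.1, z.2.1 :: z.1.2)) (fun o z => rec_use (O o z.1) f z.2)).
    - exact: IHf.
    - by cmp_auto.
    - by move=> o z [/rec_dom_mu [_ _ h] /h].
  + by move=> o z k _ _; rewrite big_ord_recr.
Qed.

Lemma cmp_rec_use_app (A : Type) `{encodable A} D c (f : (nat -> nat) -> A -> P)
    (g : (nat -> nat) -> A -> seq nat) :
  cmp D f -> cmp D g -> (forall o a, D o a -> rec_dom (O o (f o a)) c (g o a)) ->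
  cmp D (fun o a => rec_use (O o (f o a)) c (g o a)).
Proof.
move=> hf hg hd; apply: (cmp_comp (cmp_rec_use c) (f := fun o a => (f o a, g o a))) => //.
by cmp_auto.
Qed.

End Substitution.

(** A program specified for the zero oracle may still contain [ROracle]; substituting the zero
    oracle makes it usable under any oracle. *)
Lemma cmp_no_oracle (A : Type) `{encodable A} D c (F : (nat -> nat) -> A -> nat)
    (xs : (nat -> nat) -> A -> seq nat) :
  cmp D xs -> (forall o a, D o a -> rec_eval no_oracle c (xs o a) (F o a)) -> cmp D F.
Proof.
move=> hxs hF.
apply: (@cmp_ext _ _ nat _ _ _ (fun o a => rec_val no_oracle c (xs o a))); last first.
  by move=> o a /hF /rec_valE.
apply: (@cmp_rec_val_app nat _ (fun _ _ => no_oracle) _ _ _ _ _ (fun _ _ => 0%N)) => //.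
- exact: cmp_cst.
- exact: cmp_cst.
- by move=> o a /hF h; exists (F o a).
Qed.

Lemma cmp_computable_nat (A : Type) `{encodable A} D (f : nat -> nat) (g : (nat -> nat)
  -> A -> nat) :
  computable_nat f -> cmp D g -> cmp D (fun o a => f (g o a)).
Proof.
move=> [c hc] hg; apply: (@cmp_no_oracle _ _ _ c _ (fun o a => [:: g o a])) => //.
by apply: cmp_cons => //; apply: cmp_cst.
Qed.

Lemma cmp_code_pair (f : nat -> nat -> nat) :
  cmp (fun _ _ => True) (fun o z => f z.1 z.2) ->
  exists c, forall o a b, rec_eval o c [:: a; b] (f a b).
Proof.
case=> c hc; exists (RComp c [:: RComp rpairn [:: RProj 0; RProj 1]]) => o a b.
apply: rec_comp1; last by apply: (hc o (a, b)).
by apply: rec_comp2; last exact: rpairnP.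
Qed.

(** * Codes of rational numbers *)

Import Order.TTheory GRing.Theory Num.Theory.
Import numFieldNormedType.Exports.

Definition qpos x := (unpair (unpair x).1).1.
Definition qneg x := (unpair (unpair x).1).2.
Definition qden x := (unpair x).2.+1.
(** The denominator is stored minus one. Fractions are never reduced, so the arithmetic below is
    plain cross multiplication. *)
Definition mkq p n d := pairn (pairn p n) d.-1.

Definition qadd x y := mkq (qpos x * qden y + qpos y * qden x)
  (qneg x * qden y + qneg y * qden x) (qden x * qden y).
Definition qmul x y := mkq (qpos x * qpos y + qneg x * qneg y)
  (qpos x * qneg y + qneg x * qpos y) (qden x * qden y).
Definition qopp x := mkq (qneg x) (qpos x) (qden x).
(** Cross-multiplied comparison, with the negative parts moved across so that no truncated
    subtraction occurs. *)
Definition qle x y := (qpos x * qden y + qneg y * qden x <=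
  qpos y * qden x + qneg x * qden y)%N.
Definition qmin x y := if qle x y then x else y.
Definition qmax x y := if qle x y then y else x.
Definition qabs x := qmax x (qopp x).
Definition qnat n := mkq n 0 1.
Definition qdyadic n k := mkq n 0 (2 ^ k).

Section CmpRat.
Context {A : Type} `{encodable A}.
Variable D : (nat -> nat) -> A -> Prop.
Implicit Types f g : (nat -> nat) -> A -> nat.

Lemma cmp_qadd f g : cmp D f -> cmp D g -> cmp D (fun o a => qadd (f o a) (g o a)).
Proof. by move=> *; rewrite /qadd /mkq /qpos /qneg /qden; cmp_auto. Qed.

Lemma cmp_qmul f g : cmp D f -> cmp D g -> cmp D (fun o a => qmul (f o a) (g o a)).
Proof. by move=> *; rewrite /qmul /mkq /qpos /qneg /qden; cmp_auto. Qed.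

Lemma cmp_qopp f : cmp D f -> cmp D (fun o a => qopp (f o a)).
Proof. by move=> *; rewrite /qopp /mkq /qpos /qneg /qden; cmp_auto. Qed.

Lemma cmp_qle f g : cmp D f -> cmp D g -> cmp D (fun o a => qle (f o a) (g o a)).
Proof. by move=> *; rewrite /qle /mkq /qpos /qneg /qden; cmp_auto. Qed.

Lemma cmp_qdyadic f g : cmp D f -> cmp D g -> cmp D (fun o a => qdyadic (f o a) (g o a)).
Proof. by move=> *; rewrite /qdyadic /mkq; cmp_auto. Qed.

Lemma cmp_qnat f : cmp D f -> cmp D (fun o a => qnat (f o a)).
Proof. by move=> *; rewrite /qnat /mkq; cmp_auto. Qed.
End CmpRat.
#[global] Hint Resolve cmp_qadd cmp_qmul cmp_qopp cmp_qle cmp_qdyadic cmp_qnat : cmp.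

Section CmpMinMax.
Context {A : Type} `{encodable A}.
Variable D : (nat -> nat) -> A -> Prop.
Implicit Types f g : (nat -> nat) -> A -> nat.

Lemma cmp_qmin f g : cmp D f -> cmp D g -> cmp D (fun o a => qmin (f o a) (g o a)).
Proof.
move=> hf hg; apply: cmp_if; first by cmp_auto.
  by apply: cmp_sub hf _ => ? ? [].
by apply: cmp_sub hg _ => ? ? [].
Qed.

Lemma cmp_qmax f g : cmp D f -> cmp D g -> cmp D (fun o a => qmax (f o a) (g o a)).
Proof.
move=> hf hg; apply: cmp_if; first by cmp_auto.
  by apply: cmp_sub hg _ => ? ? [].
by apply: cmp_sub hf _ => ? ? [].
Qed.
End CmpMinMax.
#[global] Hint Resolve cmp_qmin cmp_qmax : cmp.

Lemma cmp_qabs (A : Type) `{encodable A} D (f : (nat -> nat) -> A -> nat) :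
  cmp D f -> cmp D (fun o a => qabs (f o a)).
Proof. by move=> hf; rewrite /qabs; cmp_auto. Qed.
#[global] Hint Resolve cmp_qabs : cmp.

Section RatVal.
Variable R : realType.
Local Open Scope ring_scope.

Definition rv (x : nat) : R := ratr (rat_of_code x).

Lemma rvE x : rv x = ((qpos x)%:R - (qneg x)%:R) / (qden x)%:R.
Proof.
rewrite /rv /rat_of_code /qpos /qneg /qden.
case: (unpair x) => a d; case: (unpair a) => p q /=.
by rewrite rmorphM /= fmorphV rmorphB /= !ratr_nat.
Qed.

Lemma rv_mkq p n d : (0 < d)%N -> rv (mkq p n d) = (p%:R - n%:R) / d%:R.
Proof. by move=> d0; rewrite rvE /qpos /qneg /qden /mkq !pairnK /= prednK. Qed.

Lemma qden_gt0 x : 0 < (qden x)%:R :> R. Proof. by rewrite ltr0n. Qed.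
Lemma qden_neq0 x : (qden x)%:R != 0 :> R. Proof. by rewrite pnatr_eq0. Qed.

Lemma rv_add x y : rv (qadd x y) = rv x + rv y.
Proof.
rewrite rv_mkq // !rvE !natrD !natrM.
by have := qden_neq0 x; have := qden_neq0 y => ? ?; field; apply/andP.
Qed.

Lemma rv_mul x y : rv (qmul x y) = rv x * rv y.
Proof.
rewrite rv_mkq // !rvE !natrD !natrM.
by have := qden_neq0 x; have := qden_neq0 y => ? ?; field; apply/andP.
Qed.

Lemma rv_opp x : rv (qopp x) = - rv x.
Proof. by rewrite rv_mkq // !rvE; have := qden_neq0 x => ?; field. Qed.

Lemma qleP x y : qle x y = (rv x <= rv y).
Proof.
rewrite !rvE ler_pdivrMr ?qden_gt0 // mulrAC ler_pdivlMr ?qden_gt0 //.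
rewrite !mulrBl -!natrM lerBlDr addrAC lerBrDr -!natrD ler_nat.
by rewrite /qle.
Qed.

Lemma rv_min x y : rv (qmin x y) = Num.min (rv x) (rv y).
Proof. by rewrite /qmin qleP; case: leP. Qed.

Lemma rv_max x y : rv (qmax x y) = Num.max (rv x) (rv y).
Proof. by rewrite /qmax qleP; case: leP. Qed.

Lemma rv_abs x : rv (qabs x) = `|rv x|.
Proof. by rewrite /qabs rv_max rv_opp maxrN. Qed.

Lemma rv_nat n : rv (qnat n) = n%:R.
Proof. by rewrite rv_mkq // divr1 subr0. Qed.

Lemma rv_dyadic n k : rv (qdyadic n k) = n%:R / 2 ^+ k.
Proof. by rewrite rv_mkq ?expn_gt0 // subr0 natrX. Qed.

Lemma rv_bound x : `|rv x| <= (qpos x + qneg x)%:R.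
Proof.
rewrite rvE normrM normfV (gtr0_norm (qden_gt0 x)) ler_pdivrMr ?qden_gt0 //.
apply: (@le_trans _ _ (qpos x + qneg x)%:R); last by rewrite ler_peMr ?ler0n // ler1n.
by rewrite (le_trans (ler_normB _ _)) // !ger0_norm ?ler0n // natrD.
Qed.

Lemma rv_dense (x e : R) : 0 < e -> exists q, `|rv q - x| < e.
Proof.
move=> e0.
have [k ke] : exists k, e^-1 < 2 ^+ k.
  exists (Num.truncn e^-1).+1; apply: lt_le_trans (truncnS_gt _) _.
  by rewrite -natrX ler_nat; apply: ltnW; apply: ltn_expl.
have {}ke : 2 ^- k < e by rewrite invf_plt ?posrE // exprn_gt0.
(* Round down to a multiple of 2^-k. The code below splits on the sign of z because positive and
   negative parts are stored separately. *)
pose z := Num.floor (x * 2 ^+ k).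
exists (if 0 <= z then mkq `|z|%N 0 (2 ^ k) else mkq 0 `|z|%N (2 ^ k)).
have -> : rv (if 0 <= z then mkq `|z|%N 0 (2 ^ k) else mkq 0 `|z|%N (2 ^ k)) = z%:~R / 2 ^+ k.
  have [z0|z0] := leP 0 z; rewrite rv_mkq ?expn_gt0 // natrX.
    by rewrite subr0 natr_absz ger0_norm.
  by rewrite sub0r natr_absz ltr0_norm // mulrNz opprK.
have p0 : 0 < 2 ^+ k :> R by rewrite exprn_gt0.
apply: lt_trans ke; rewrite distrC.
have /andP [h1 h2] := Num.Theory.real_floor_itv (num_real (x * 2 ^+ k)).
rewrite -/z in h1 h2.
have -> : x - z%:~R / 2 ^+ k = (x * 2 ^+ k - z%:~R) / 2 ^+ k.
  by rewrite mulrBl mulfK // gt_eqF.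
rewrite normrM normfV (gtr0_norm p0) -[X in _ < X]mul1r ltr_pM2r ?invr_gt0 //.
by rewrite ger0_norm ?subr_ge0 // ltrBlDr addrC -[X in _ + X]/(1%:~R) -intrD.
Qed.

End RatVal.

(** * Moduli, compactness and the sup norm *)

Local Open Scope ring_scope.

Notation normc := ComplexField.Normc.normc.

Section Normc.
Variable R : realType.
Implicit Types z w : R[i].

Lemma normcE_num z : `|z| = (normc z)%:C%C.
Proof. by case: z => a b; rewrite normc_def. Qed.

Lemma normc_ge0 z : 0 <= normc z.
Proof. by case: z => a b; apply: sqrtr_ge0. Qed.

Lemma normcD z w : normc (z + w) <= normc z + normc w.
Proof. by rewrite -lecR rmorphD /= -!normcE_num ler_normD. Qed.

Lemma normcM z w : normc (z * w) = normc z * normc w.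
Proof. exact: ComplexField.Normc.normcM. Qed.

Lemma normcN z : normc (- z) = normc z.
Proof. by case: z => a b; rewrite /normc /= !sqrrN. Qed.

Lemma normcB z w : normc (z - w) = normc (w - z).
Proof. by rewrite -normcN opprB. Qed.

Lemma normc_tri z w t : normc (z - t) <= normc (z - w) + normc (w - t).
Proof. by apply: le_trans (normcD _ _); rewrite addrA subrK. Qed.

Lemma normc_diff z w : normc z <= normc w + normc (z - w).
Proof. by rewrite addrC; apply: le_trans (normcD _ _); rewrite subrK. Qed.

Lemma normc0 : normc (0 : R[i]) = 0.
Proof. by rewrite /normc /= expr0n /= addr0 sqrtr0. Qed.

Lemma normc_real (x : R) : normc x%:C%C = `|x|.
Proof. by rewrite /normc /= expr0n /= addr0 sqrtr_sqr. Qed.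

Lemma normc_Re_le z : `|complex.Re z| <= normc z.
Proof.
case: z => a b; rewrite /normc /= -sqrtr_sqr ler_sqrt ?addr_ge0 ?sqr_ge0 //.
by rewrite lerDl sqr_ge0.
Qed.

Lemma normc_Im_le z : `|complex.Im z| <= normc z.
Proof.
case: z => a b; rewrite /normc /= -sqrtr_sqr ler_sqrt ?addr_ge0 ?sqr_ge0 //.
by rewrite lerDr sqr_ge0.
Qed.

Lemma normc_l1 z : normc z <= `|complex.Re z| + `|complex.Im z|.
Proof.
case: z => a b; rewrite /normc /= -[X in _ <= X]ger0_norm ?addr_ge0 //.
rewrite -sqrtr_sqr ler_sqrt ?sqr_ge0 // sqrrD !real_normK ?num_real //.
by rewrite addrAC lerDl mulrn_wge0 // mulr_ge0.
Qed.

Lemma normc_sqr z : normc z ^+ 2 = complex.Re z ^+ 2 + complex.Im z ^+ 2.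
Proof. by case: z => a b; rewrite /normc /= sqr_sqrtr // addr_ge0 ?sqr_ge0. Qed.

End Normc.

Section Dyadic.
Variable R : realType.

Lemma half_pow_gt0 k : 0 < 2 ^- k :> R.
Proof. by rewrite invr_gt0 exprn_gt0. Qed.

Lemma half_powS k : 2 ^- k = 2 * 2 ^- k.+1 :> R.
Proof. by rewrite exprS invfM mulrA divff ?mul1r. Qed.

Lemma half_powD k j : 2 ^- (k + j) = 2 ^- k * 2 ^- j :> R.
Proof. by rewrite exprD invfM. Qed.

Lemma half_pow_le k j : (k <= j)%N -> 2 ^- j <= 2 ^- k :> R.
Proof. by move=> kj; rewrite lef_pV2 ?posrE ?exprn_gt0 // ler_weXn2l // ler1n. Qed.

Lemma half_pow_small (e : R) : 0 < e -> exists N, forall k, (N <= k)%N -> 2 ^- k < e.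
Proof.
move=> e0; exists (Num.truncn e^-1).+1 => k kN.
rewrite invf_plt ?posrE ?exprn_gt0 //; apply: lt_le_trans (truncnS_gt _) _.
by rewrite -natrX ler_nat; apply: leq_trans kN _; apply: ltnW; apply: ltn_expl.
Qed.

(** Since K <= 2^K, working at precision K + k absorbs an error constant K. *)
Lemma nat_half_pow K k : K%:R * 2 ^- (K + k) <= 2 ^- k :> R.
Proof.
rewrite half_powD mulrA ler_piMl ?(ltW (half_pow_gt0 _)) // ler_pdivrMr ?exprn_gt0 // mul1r.
by rewrite -natrX ler_nat; apply: ltnW; apply: ltn_expl.
Qed.

End Dyadic.

(** * Consequences of compactness *)

Section Compact.
Variables (R : realType) (X : topologicalType) (d : X -> X -> R).
Hypothesis hX : compact [set: X].
Hypothesis hd : compatible_metric d.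

Lemma cmetric_refl x : d x x = 0. Proof. by case: hd => -[h _ _] _; apply/h. Qed.
Lemma cmetric_sym x y : d x y = d y x. Proof. by case: hd => -[_ h _] _; apply: h. Qed.
Lemma cmetric_tri y x z : d x z <= d x y + d y z. Proof. by case: hd => -[_ _ h] _; apply: h. Qed.
Lemma cmetric_ge0 x y : 0 <= d x y.
Proof. by have := cmetric_tri y x x; rewrite cmetric_refl (cmetric_sym y x); lra. Qed.

(** The form in which compactness is used throughout: what holds from some stage on near each point
    holds from one stage on everywhere. Uniform continuity, boundedness and the existence of
    certificates are instances. *)
Lemma compact_eventually (Q : nat -> X -> Prop) :
  (forall x, exists2 e : R, 0 < e & exists N, forall n y, (N <= n)%N -> d x y < e -> Q n y) ->
  exists N, forall n x, (N <= n)%N -> Q n x.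
Proof.
move=> h.
have /compact_near_coveringP hc := hX.
have [|N _ hN] := hc nat \oo%classic Q _.
  move=> x _; have [e e0 [N hN]] := h x.
  exists ([set y | d x y < e], [set n | (N <= n)%N]); last first.
    by move=> [y n] /= [ye nN]; apply: hN.
  split=> /=; last by exists N.
  by apply/(hd.2); exists e.
by exists N => n x nN; apply: hN.
Qed.

Lemma cstar_local (f : cstar R X) x (e : R) : 0 < e ->
  exists2 t, 0 < t & forall y, d x y < t -> normc (f x - f y) < e.
Proof.
move=> e0.
have /(@cvgrPdist_lt _ R[i]^o)/(_ e%:C%C) := @cts_fun _ _ f x.
rewrite ltcR => /(_ e0) /(hd.2) [t t0 ht]; exists t => // y yt.
by have := ht y yt; rewrite /= normcE_num ltcR.
Qed.

Lemma cstar_unif (f : cstar R X) (e : R) : 0 < e ->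
  exists N, forall x y, d x y < 2 ^- N -> normc (f x - f y) < e.
Proof.
move=> e0.
have [|N hN] := @compact_eventually
  (fun n x => forall y, d x y < 2 ^- n -> normc (f x - f y) < e).
  move=> x; have [|t t0 ht] := @cstar_local f x (e / 2); first by rewrite divr_gt0.
  have t2 : 0 < t / 2 by rewrite divr_gt0.
  have [N hN] := half_pow_small t2.
  exists (t / 2) => //; exists N => n y nN xy z yz.
  have h1 := ht y.
  have h2 := ht z; have h3 := cmetric_tri y x z; have h4 := hN _ nN.
  have h5 := normc_tri (f y) (f x) (f z); rewrite (normcB (f y) (f x)) in h5.
  have {}h1 : normc (f x - f y) < e / 2 by apply: h1; lra.
  have {}h2 : normc (f x - f z) < e / 2 by apply: h2; lra.
  lra.
by exists N => x y; apply: (hN N x).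
Qed.

Lemma cstar_bounded (f : cstar R X) : exists M : nat, forall x, normc (f x) <= M%:R.
Proof.
have [|N hN] := @compact_eventually (fun n x => normc (f x) <= n%:R); last first.
  by exists N => x; apply: hN.
move=> x; have [t t0 ht] := @cstar_local f x _ ltr01.
exists t => //; exists (Num.truncn (normc (f x) + 1)).+1 => n y nN /ht xy.
apply: (@le_trans _ _ (normc (f x) + 1)).
  by have := normc_diff (f y) (f x); rewrite (normcB (f y) (f x)); lra.
by apply: ltW; apply: lt_le_trans (truncnS_gt _) _; rewrite ler_nat.
Qed.

(** The bound is chosen non-effectively; it enters the programs below as a fixed constant. *)
Lemma metric_bounded : exists M : nat, forall x y, d x y <= M%:R.
Proof.
have [M hM] : exists M : nat, forall x y, d x y <= M%:R + d y y + M%:R.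
  have [x0|nX] := pselect (exists x : X, True); last by exists 0%N => x; case: nX; exists x.
  case: x0 => x0 _.
  have [|N hN] := @compact_eventually (fun n x => d x0 x <= n%:R).
    move=> x; exists 1 => //; exists (Num.truncn (d x0 x + 1)).+1 => n y nN xy.
    apply: (@le_trans _ _ (d x0 x + 1)); first by have := cmetric_tri x x0 y; lra.
    by apply: ltW; apply: lt_le_trans (truncnS_gt _) _; rewrite ler_nat.
  exists N => x y; rewrite cmetric_refl addr0.
  have := hN N x (leqnn _); have := hN N y (leqnn _).
  by have := cmetric_tri x0 x y; rewrite (cmetric_sym x x0); lra.
by exists (M + M)%N => x y; rewrite natrD; have := hM x y; rewrite cmetric_refl addr0.
Qed.

(** Boundedness on the compact space makes [sup] a genuine supremum instead of its default value. *)
Lemma supnorm_ge (f : cstar R X) x : normc (f x) <= supnorm f.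
Proof.
apply: ub_le_sup; last by exists x.
by have [M hM] := cstar_bounded f; exists M%:R => _ [y _ <-].
Qed.

Lemma supnorm_le (f : cstar R X) (x0 : X) c : (forall x, normc (f x) <= c) -> supnorm f <= c.
Proof.
by move=> h; apply: ge_sup; [exists (normc (f x0)); exists x0 | move=> _ [x _ <-]].
Qed.

Lemma lipschitz_continuous (g : X -> R) (L : R) :
  (forall x y, `|g x - g y| <= L * d x y) ->
  continuous (fun x => (g x)%:C%C : R[i]^o).
Proof.
move=> hg x; apply/(@cvgrPdist_lt _ R[i]^o) => e e0.
(* A positive element of R[i] is real. *)
have [e' ee'] : exists e' : R, e = e'%:C%C.
  by exists (complex.Re e); rewrite RRe_real // ger0_real // ltW.
rewrite {}ee' in e0 *; rewrite ltcR in e0.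
(* [L] may be zero or negative, so the radius is divided by |L| + 1. *)
have L0 : 0 < `|L| + 1 by apply: ltr_pwDr.
apply/(hd.2); exists (e' / (`|L| + 1)); first by rewrite divr_gt0.
move=> y /=; rewrite ltr_pdivlMr // => xy.
rewrite -rmorphB normcE_num ltcR normc_real.
apply: le_lt_trans (hg x y) _; apply: le_lt_trans xy; rewrite mulrC ler_wpM2l ?cmetric_ge0 //.
by have := ler_norm L; lra.
Qed.

End Compact.

Section Pointwise.
Variables (R : realType) (X : topologicalType).
Implicit Types f g : cstar R X.

Lemma cstar_subE f g x : (f - g) x = f x - g x. Proof. by []. Qed.

Lemma cstar_sumE (I : Type) (s : seq I) (F : I -> cstar R X) x :
  (\sum_(i <- s) F i) x = \sum_(i <- s) F i x.
Proof. by elim: s => [|i s IH]; rewrite ?big_nil // !big_cons -IH. Qed.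

Lemma cstar_prodE (I : Type) (s : seq I) (F : I -> cstar R X) x :
  (\prod_(i <- s) F i) x = \prod_(i <- s) F i x.
Proof. by elim: s => [|i s IH]; rewrite ?big_nil // !big_cons -IH. Qed.

End Pointwise.

(** * Existence *)

Section RealFolds.
Variable R : realType.
Implicit Types (s : seq nat) (t : nat -> R).

Lemma foldl_minr_le t s z k : k \in s ->
  foldl (fun acc m => Num.min acc (t m)) z s <= t k.
Proof.
elim/last_ind: s => // s m IH; rewrite mem_rcons in_cons foldl_rcons => /orP [/eqP -> | /IH h].
  by rewrite ge_min lexx orbT.
by rewrite ge_min h.
Qed.

Lemma foldl_minr_ge t s z A : A <= z -> (forall k, k \in s -> A <= t k) ->
  A <= foldl (fun acc m => Num.min acc (t m)) z s.
Proof.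
move=> Az; elim/last_ind: s => // s m IH h;
  rewrite foldl_rcons le_min IH ?h ?mem_rcons ?mem_head //.
by move=> k ks; apply: h; rewrite mem_rcons in_cons ks orbT.
Qed.

(** The errors are added where a maximum would do, to match the additive recursion of [genK]. *)
Lemma min_diff (a b a' b' e e' : R) : `|a - a'| <= e -> `|b - b'| <= e' ->
  `|Num.min a b - Num.min a' b'| <= e + e'.
Proof. by rewrite !ler_distl => /andP [? ?] /andP [? ?]; case: (leP a b) => ?;
  case: (leP a' b') => ?; apply/andP; split; lra. Qed.

(** The 3 is 1 + 2: the difference is (a - a') b + a' (b - b'), and h <= 1 gives |a'| <= 2C. *)
Lemma mul_diff (a b a' b' C C' h : R) : 0 <= C -> 0 <= C' -> 0 <= h -> h <= 1 ->
  `|a| <= C -> `|b| <= C' -> `|a - a'| <= C * h -> `|b - b'| <= C' * h ->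
  `|a * b - a' * b'| <= 3 * C * C' * h.
Proof.
move=> C0 C0' h0 h1 aC bC aa bb.
have -> : a * b - a' * b' = (a - a') * b + a' * (b - b') by ring.
have a'C : `|a'| <= 2 * C.
  have hC : C * h <= C by rewrite ler_piMr.
  rewrite (_ : a' = a - (a - a')); last by ring.
  by apply: le_trans (ler_normB _ _) _; lra.
apply: le_trans (ler_normD _ _) _; rewrite !normrM.
have h2 : `|a - a'| * `|b| <= (C * h) * C' by apply: ler_pM.
have h3 : `|a'| * `|b - b'| <= (2 * C) * (C' * h) by apply: ler_pM.
have -> : 3 * C * C' * h = (C * h) * C' + (2 * C) * (C' * h) by ring.
lra.
Qed.

End RealFolds.

(** A natural bound on |q| that can be read off its code ([rv_bound]). *)
Definition qheight x := (qpos x + qneg x)%N.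

Lemma cmp_qheight (A : Type) `{encodable A} D (f : (nat -> nat) -> A -> nat) :
  cmp D f -> cmp D (fun o a => qheight (f o a)).
Proof. by move=> *; rewrite /qheight /qpos /qneg; cmp_auto. Qed.
#[global] Hint Resolve cmp_qheight : cmp.

Lemma normc_qi (R : realType) n :
  qi_val (qi_of_code n) = (rv R (unpair n).1 +i* rv R (unpair n).2)%C.
Proof. by []. Qed.

Section Existence.
Variables (R : realType) (X : topologicalType) (Xs : presented R X).
Hypothesis hX : compact [set: X].
Hypothesis hXs : space_presentation Xs.
Local Notation d := (pdist Xs).
Local Notation p := (ppoint Xs).
Variables (cd : recfun) (dq : nat -> nat -> nat -> nat).
Hypothesis dq_code : forall i j k, rec_eval no_oracle cd [:: i; j; k] (dq i j k).
Hypothesis dq_near : forall i j k, `|d (p i) (p j) - rv R (dq i j k)| < 2 ^- k.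
Variable tb : nat -> nat.
Hypothesis tb_comp : computable_nat tb.
Hypothesis tb_cover : total_boundedness_function Xs tb.
Variable M : nat.
Hypothesis d_le : forall x y, d x y <= M%:R.

Let hd : compatible_metric d := hXs.1.

Lemma cmp_dq (A : Type) `{encodable A} D (f g h : (nat -> nat) -> A -> nat) :
  cmp D f -> cmp D g -> cmp D h -> cmp D (fun o a => dq (f o a) (g o a) (h o a)).
Proof.
move=> hf hg hh; apply: (@cmp_no_oracle _ _ _ cd _ (fun o a => [:: f o a; g o a; h o a])).
  by cmp_auto.
by move=> o a _; apply: dq_code.
Qed.
Hint Resolve cmp_dq : cmp.

Lemma cmp_tb (A : Type) `{encodable A} D (f : (nat -> nat) -> A -> nat) :
  cmp D f -> cmp D (fun o a => tb (f o a)).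
Proof. exact: cmp_computable_nat. Qed.
Hint Resolve cmp_tb : cmp.

Lemma tb_ball J x : exists2 k, k \in CodeSeq.decode (tb J) & d (p k) x < 2 ^- J.
Proof. by have : [set: X] x by []; rewrite (tb_cover J) => -[k /= kJ kx]; exists k. Qed.

(* The term q + N d(p_k, .) has code pairn (pairn q N) k. *)
Definition tq m := (unpair (unpair m).1).1.
Definition tN m := (unpair (unpair m).1).2.
Definition tk m := (unpair m).2.

Definition termv m x : R := rv R (tq m) + (tN m)%:R * d (p (tk m)) x.
Definition termE m i J := qadd (tq m) (qmul (qnat (tN m)) (dq (tk m) i J)).
(** One constant for three purposes: a bound on the term (height plus N M), the factor of its
    approximation error (2 N), and a Lipschitz constant (N). *)
Definition termK m := (qheight (tq m) + tN m * (M + 2))%N.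

Definition genv n x : R :=
  foldl (fun acc m => Num.min acc (termv m x)) (rv R (unpair n).1) (CodeSeq.decode (unpair n).2).
Definition genE n i J :=
  foldl (fun acc m => qmin acc (termE m i J)) (unpair n).1 (CodeSeq.decode (unpair n).2).
Definition genK n :=
  foldl (fun acc m => acc + termK m)%N (qheight (unpair n).1) (CodeSeq.decode (unpair n).2).

(** One 2^-J pays for moving from x to p_i, the other for the rational approximation of the
    distance. *)
Lemma d_approx m i J x : d (p i) x < 2 ^- J -> `|d (p m) x - rv R (dq m i J)| <= 2 * 2 ^- J.
Proof.
move=> ix; have := dq_near m i J; rewrite ltr_distl ler_distl => /andP [? ?].
have := cmetric_tri hd (p i) (p m) x; have := cmetric_tri hd x (p m) (p i).
by rewrite (cmetric_sym hd x (p i)) => ? ?; apply/andP; split; lra.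
Qed.

Lemma term_bound m x : `|termv m x| <= (termK m)%:R.
Proof.
rewrite /termv /termK natrD natrM; apply: le_trans (ler_normD _ _) _;
  apply: lerD (rv_bound _ _) _.
rewrite normrM ger0_norm ?ler0n // ler_wpM2l ?ler0n // ger0_norm ?(cmetric_ge0 hd) //.
by rewrite natrD; have := d_le (p (tk m)) x; lra.
Qed.

Lemma term_near m i J x : d (p i) x < 2 ^- J ->
  `|termv m x - rv R (termE m i J)| <= (termK m)%:R * 2 ^- J.
Proof.
move=> ix; rewrite /termv /termE rv_add rv_mul rv_nat opprD addrACA subrr add0r -mulrBr.
rewrite normrM ger0_norm ?ler0n // /termK natrD natrM natrD.
have h0 := half_pow_gt0 R J.
have h1 : 0 <= (qheight (tq m))%:R :> R by rewrite ler0n.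
have h2 : 0 <= M%:R :> R by rewrite ler0n.
apply: (@le_trans _ _ ((tN m)%:R * ((M%:R + 2) * 2 ^- J))).
  rewrite ler_wpM2l ?ler0n //; apply: le_trans (d_approx _ ix) _.
  by rewrite ler_pM2r //; lra.
by rewrite mulrA ler_pM2r //; lra.
Qed.

Lemma term_lip m x y : `|termv m x - termv m y| <= (termK m)%:R * d x y.
Proof.
rewrite /termv opprD addrACA subrr add0r -mulrBr normrM ger0_norm ?ler0n //.
rewrite /termK natrD natrM natrD.
have h0 := cmetric_ge0 hd x y.
have h1 : 0 <= (qheight (tq m))%:R :> R by rewrite ler0n.
have h2 : 0 <= M%:R :> R by rewrite ler0n.
apply: (@le_trans _ _ ((tN m)%:R * ((M%:R + 2) * d x y))).
  rewrite ler_wpM2l ?ler0n //; apply: (@le_trans _ _ (d x y)).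
    have := cmetric_tri hd x (p (tk m)) y; have := cmetric_tri hd y (p (tk m)) x.
    by rewrite (cmetric_sym hd y x) ler_distl => ? ?; apply/andP; split; lra.
  by rewrite ler_peMl //; lra.
by rewrite mulrA ler_wpM2r //; lra.
Qed.

Lemma gen_bound n x : `|genv n x| <= (genK n)%:R.
Proof.
rewrite /genv /genK; elim/last_ind: (CodeSeq.decode _) => [|s m IH]; first exact: rv_bound.
rewrite !foldl_rcons natrD.
have := term_bound m x; move: IH; set a := foldl _ _ _; set k := foldl _ _ _.
by rewrite !ler_norml => /andP [? ?] /andP [? ?]; case: (leP a (termv m x)) => ?; apply/andP;
  split; lra.
Qed.

Lemma gen_near n i J x : d (p i) x < 2 ^- J ->
  `|genv n x - rv R (genE n i J)| <= (genK n)%:R * 2 ^- J.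
Proof.
move=> ix; rewrite /genv /genK /genE; elim/last_ind: (CodeSeq.decode _) => [|s m IH].
  by rewrite subrr normr0 mulr_ge0 ?ler0n // ltW // half_pow_gt0.
rewrite !foldl_rcons natrD rv_min mulrDl; apply: min_diff => //; exact: term_near.
Qed.

Lemma gen_lip n x y : `|genv n x - genv n y| <= (genK n)%:R * d x y.
Proof.
rewrite /genv /genK; elim/last_ind: (CodeSeq.decode _) => [|s m IH].
  by rewrite subrr normr0 mulr_ge0 ?ler0n // (cmetric_ge0 hd).
rewrite !foldl_rcons natrD mulrDl; apply: min_diff => //; exact: term_lip.
Qed.

Definition gen n : cstar R X := mkcts (lipschitz_continuous hd (gen_lip n)).

(** A letter code l stands for x_(l/2) or its adjoint according to parity. The generators are
    real-valued, so only l/2 matters. *)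
Definition wordv (w : seq nat) x : R := \prod_(l <- w) genv l./2 x.
Definition wordE w i J := foldl (fun acc l => qmul acc (genE l./2 i J)) (qnat 1) w.
(** At once a bound on the word and an error factor; the 3 comes from [mul_diff]. *)
Definition wordK w := foldl (fun acc l => 3 * acc * genK l./2)%N 1%N w.

(** The bound and the error are proved together, since the error of a product depends on the size of
    its factors. *)
Lemma word_near w i J x : d (p i) x < 2 ^- J ->
  `|wordv w x| <= (wordK w)%:R /\
  `|wordv w x - rv R (wordE w i J)| <= (wordK w)%:R * 2 ^- J.
Proof.
move=> ix; rewrite /wordv /wordE /wordK; have h0 := half_pow_gt0 R J.
elim/last_ind: w => [|w l [IH1 IH2]].
  rewrite big_nil /= rv_nat subrr normr0 normr1; split=> //; rewrite mulr_ge0 ?ler0n // ltW.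
rewrite -cats1 big_cat big_seq1 !foldl_cat /= rv_mul !natrM.
have hb := gen_bound l./2 x; split.
  rewrite normrM; apply: ler_pM => //; apply: le_trans IH1 _.
  by rewrite ler_peMl ?ler0n //; lra.
have h1 : 2 ^- J <= 1 :> R by rewrite invf_le1 ?exprn_gt0 // exprn_ege1 // ler1n.
by apply: mul_diff => //; exact: gen_near.
Qed.

Definition cre m := (unpair (unpair m).1).1.
Definition cim m := (unpair (unpair m).1).2.
Definition wcode m := CodeSeq.decode (unpair m).2.

Definition polyE n i J := foldl (fun acc m =>
   pairn (qadd (unpair acc).1 (qmul (cre m) (wordE (wcode m) i J)))
         (qadd (unpair acc).2 (qmul (cim m) (wordE (wcode m) i J))))
   (pairn (qnat 0) (qnat 0)) (CodeSeq.decode n).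
(** The coefficients are exact, so only the errors of the words count, each scaled by a bound on its
    coefficient. *)
Definition polyK n := foldl (fun acc m =>
   acc + (qheight (cre m) + qheight (cim m)) * wordK (wcode m))%N 0%N (CodeSeq.decode n).

Lemma rational_vectorE n x : rational_vector gen n x =
  \sum_(m <- CodeSeq.decode n) qi_val (qi_of_code (unpair m).1) * (wordv (wcode m) x)%:C%C.
Proof.
rewrite /rational_vector /starpoly_eval /starpoly_of_code big_map cstar_sumE.
apply: eq_bigr => m _ /=; rewrite [LHS]/(_ * _); congr (_ * _).
rewrite cstar_prodE big_map /wordv rmorph_prod; apply: eq_bigr => l _ /=.
(* An adjoint letter contributes the conjugate of a real number. *)
by case: (odd l) => //; exact: (conjc_real (genv l./2 x)).
Qed.

Lemma poly_near n i J x : d (p i) x < 2 ^- J ->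
  normc (rational_vector gen n x - qi_val (qi_of_code (polyE n i J))) <= (polyK n)%:R * 2 ^- J.
Proof.
move=> ix; rewrite rational_vectorE /polyE /polyK; have h0 := half_pow_gt0 R J.
elim/last_ind: (CodeSeq.decode n) => [|s m].
  by rewrite big_nil normc_qi pairnK !rv_nat subr0 mul0r normc0.
rewrite -cats1 big_cat big_seq1 !foldl_cat /=.
set E := foldl _ _ _; set K := foldl _ _ _; set S := \sum_(_ <- _) _ => IH.
have [_ hw] := word_near (wcode m) ix.
rewrite !normc_qi pairnK /= !rv_add !rv_mul.
set W := wordv _ _ in hw *; set V := rv R (wordE _ _ _) in hw *.
set a := rv R (cre m); set b := rv R (cim m).
have -> : S + (rv R (unpair (unpair m).1).1 +i* rv R (unpair (unpair m).1).2)%C * W%:C%C -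
   ((rv R (unpair E).1 + a * V) +i* (rv R (unpair E).2 + b * V))%C =
   (S - qi_val (qi_of_code E)) + (a +i* b)%C * (W - V)%:C%C.
  rewrite normc_qi -/a -/b; case: S {IH} => s1 s2; rewrite /a /b /cre /cim.
  apply/eqP; rewrite eq_complex /=; apply/andP; split; apply/eqP; ring.
apply: le_trans (normcD _ _) _; rewrite natrD mulrDl; apply: lerD => //.
rewrite normcM normc_real natrM -mulrA; apply: ler_pM => //; first exact: normc_ge0.
apply: le_trans (normc_l1 _) _ => /=; rewrite natrD; apply: lerD; exact: rv_bound.
Qed.

(** * Computability of the local approximations *)

Lemma cmp_genE (A : Type) `{encodable A} D (f g h : (nat -> nat) -> A -> nat) :
  cmp D f -> cmp D g -> cmp D h -> cmp D (fun o a => genE (f o a) (g o a) (h o a)).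
Proof.
move=> hf hg hh.
apply: (@cmp_app _ _ (nat * (nat * nat)) nat _ _ D (fun z => genE z.1 z.2.1 z.2.2)
  (fun o a => (f o a, (g o a, h o a)))); last by cmp_auto.
by rewrite /genE /termE /tq /tN /tk; cmp_auto.
Qed.

Lemma cmp_genK (A : Type) `{encodable A} D (f : (nat -> nat) -> A -> nat) :
  cmp D f -> cmp D (fun o a => genK (f o a)).
Proof.
apply: (@cmp_app _ _ nat nat); rewrite /genK /termK /tq /tN /tk; cmp_auto.
Qed.
Hint Resolve cmp_genE cmp_genK : cmp.

Lemma cmp_wordE (A : Type) `{encodable A} D (w : (nat -> nat) -> A -> seq nat)
    (g h : (nat -> nat) -> A -> nat) :
  cmp D w -> cmp D g -> cmp D h -> cmp D (fun o a => wordE (w o a) (g o a) (h o a)).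
Proof.
move=> hf hg hh.
apply: (@cmp_app _ _ (seq nat * (nat * nat)) nat _ _ D (fun z => wordE z.1 z.2.1 z.2.2)
  (fun o a => (w o a, (g o a, h o a)))); last by cmp_auto.
by rewrite /wordE; cmp_auto.
Qed.

Lemma cmp_wordK (A : Type) `{encodable A} D (w : (nat -> nat) -> A -> seq nat) :
  cmp D w -> cmp D (fun o a => wordK (w o a)).
Proof. apply: (@cmp_app _ _ (seq nat) nat); rewrite /wordK; cmp_auto. Qed.
Hint Resolve cmp_wordE cmp_wordK : cmp.

Lemma cmp_polyE (A : Type) `{encodable A} D (f g h : (nat -> nat) -> A -> nat) :
  cmp D f -> cmp D g -> cmp D h -> cmp D (fun o a => polyE (f o a) (g o a) (h o a)).
Proof.
move=> hf hg hh.
apply: (@cmp_app _ _ (nat * (nat * nat)) nat _ _ D (fun z => polyE z.1 z.2.1 z.2.2)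
  (fun o a => (f o a, (g o a, h o a)))); last by cmp_auto.
by rewrite /polyE /cre /cim /wcode; cmp_auto.
Qed.

Lemma cmp_polyK (A : Type) `{encodable A} D (f : (nat -> nat) -> A -> nat) :
  cmp D f -> cmp D (fun o a => polyK (f o a)).
Proof. apply: (@cmp_app _ _ nat nat); rewrite /polyK /cre /cim /wcode; cmp_auto. Qed.
Hint Resolve cmp_polyE cmp_polyK : cmp.

(** The name is read at two places. Entry k + 2 gives a rational vector within 2^-(k+2) of f, and
    this vector determines K. Entry K + k + 2 then gives a point close enough to x for the local
    approximation to err by at most 2^-(k+2). *)
Lemma gen_evaluative pr : computable_bijection pr -> evaluative pr gen Xs.
Proof.
move=> [_ pr1 pr2].
pose K (o : nat -> nat) k := polyK (pr (o k.+2)).1.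
have [c hc] : cmp (fun _ _ => True) (fun o k =>
    polyE (pr (o k.+2)).1 (pr (o (K o k + k.+2)%N)).2 (K o k + k.+2)%N).
  have h1 (A : Type) (eA : encodable A) D (f : (nat -> nat) -> A -> nat) :
    cmp D f -> cmp D (fun o a => (pr (f o a)).1) by apply: cmp_computable_nat pr1.
  have h2 (A : Type) (eA : encodable A) D (f : (nat -> nat) -> A -> nat) :
    cmp D f -> cmp D (fun o a => (pr (f o a)).2) by apply: cmp_computable_nat pr2.
  by rewrite /K; cmp_auto.
exists c => -[f x] a ha.
exists (fun k => polyE (pr (a k.+2)).1 (pr (a (K a k + k.+2)%N)).2 (K a k + k.+2)%N).
  by move=> k; apply: hc.
move=> k /=; have := ha k.+2; have := ha (K a k + k.+2)%N.
rewrite /= !gt_max => /andP [_ h1] /andP [h2 _].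
have h3 := le_trans (poly_near (pr (a k.+2)).1 h1) (nat_half_pow R _ _).
set r := rational_vector _ _ in h2 h3.
have h4 := supnorm_ge hX hd (r - f) x; rewrite cstar_subE in h4.
rewrite normcB; set q := qi_val _ in h3 *.
apply: le_lt_trans (normc_tri (f x) (r x) q) _; rewrite (normcB (f x)).
by rewrite (half_powS R k) (half_powS R k.+1); have := half_pow_gt0 R k.+2; lra.
Qed.

(** * The norm of a rational vector *)

Definition nsq z := qadd (qmul (unpair z).1 (unpair z).1) (qmul (unpair z).2 (unpair z).2).
Definition normE n J :=
  foldl (fun acc k => qmax acc (nsq (polyE n k J))) (qnat 0) (CodeSeq.decode (tb J)).

Lemma rv_nsq z : rv R (nsq z) = normc (qi_val (qi_of_code z) : R[i]) ^+ 2.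
Proof. by rewrite normc_sqr /nsq rv_add !rv_mul !expr2. Qed.

Lemma normE_ge n J k : k \in CodeSeq.decode (tb J) ->
  rv R (nsq (polyE n k J)) <= rv R (normE n J).
Proof.
rewrite /normE; elim/last_ind: (CodeSeq.decode _) => // s m IH.
rewrite mem_rcons in_cons foldl_rcons rv_max => /orP [/eqP -> | /IH h].
  by rewrite le_max lexx orbT.
by rewrite le_max h.
Qed.

Lemma normE_le n J (B : R) : 0 <= B -> (forall k, rv R (nsq (polyE n k J)) <= B) ->
  rv R (normE n J) <= B.
Proof.
move=> B0 h; rewrite /normE; elim/last_ind: (CodeSeq.decode _) => [|s m IH].
  by rewrite rv_nat.
by rewrite foldl_rcons rv_max ge_max IH h.
Qed.

Definition normJ n k := (polyK n + k.+2)%N.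
(** The least r passing the test satisfies r 2^-(k+2) <= sqrt m < (r+1) 2^-(k+2), where m is the
    maximal squared modulus: an integer square root on a dyadic grid. *)
Definition root_test n k r := ~~ qle (qdyadic (r.+1 * r.+1) (k.+2 + k.+2)) (normE n (normJ n k)).

Lemma root_testP n k r :
  root_test n k r = (rv R (normE n (normJ n k)) < (r.+1%:R / 2 ^+ k.+2) ^+ 2).
Proof.
by rewrite /root_test (qleP R) -ltNge rv_dyadic natrM exprD -mulf_div -expr2.
Qed.

Lemma root_test_ex n k : exists r, root_test n k r.
Proof.
set m := normE n (normJ n k).
(* With h the height of m, this r makes the right-hand side at least (h+1)^2, which exceeds h and so
   m. *)
exists ((qheight m).+1 * 2 ^ k.+2)%N; rewrite root_testP -/m.
apply: le_lt_trans (ler_norm _) _; apply: le_lt_trans (rv_bound _ _) _.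
have p0 : 0 < 2 ^+ k.+2 :> R by rewrite exprn_gt0.
rewrite -/(qheight m); set h := qheight m.
apply: (@lt_le_trans _ _ (h.+1%:R)); first by rewrite ltr_nat.
apply: (@le_trans _ _ (h.+1%:R ^+ 2)); first by rewrite -natrX ler_nat leq_pmull.
rewrite ler_sqr ?nnegrE ?ler0n ?divr_ge0 ?(ltW p0) // ler_pdivlMr //.
rewrite -natrX -natrM ler_nat.
exact: leqnSn.
Qed.

Definition root n k := ex_minn (root_test_ex n k).

Lemma cmp_root : cmp (fun _ _ => True) (fun _ z => root z.1 z.2).
Proof.
apply: (@cmp_mu _ _ _ _ (fun _ z r => root_test z.1 z.2 r)).
- by rewrite /root_test /normE /nsq /normJ; cmp_auto.
- by move=> _ [n k] _ /=; rewrite /root; case: ex_minnP.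
- move=> _ [n k] m _ /=; rewrite /root; case: ex_minnP => r _ h mr.
  by apply/negP => /h; rewrite leqNgt mr.
Qed.

Lemma root_near n k :
  `|supnorm (rational_vector gen n) - rv R (qdyadic (root n k) k.+2)| < 2 ^- k.
Proof.
rewrite /root; case: ex_minnP => r; rewrite root_testP => hr rmin.
set f := rational_vector gen n; set J := normJ n k in hr.
have p0 : 0 < 2 ^+ k.+2 :> R by rewrite exprn_gt0.
have S0 : 0 <= supnorm f by apply: le_trans (normc_ge0 (f (p 0%N))) (supnorm_ge hX hd f _).
have hK := nat_half_pow R (polyK n) k.+2; rewrite -/J in hK.
have h0 := half_pow_gt0 R k.+2.
(* Every x lies in a ball of the cover, and there the approximation at the centre has modulus below
   (r+1) 2^-(k+2). *)
have up : supnorm f <= r.+1%:R / 2 ^+ k.+2 + 2 ^- k.+2.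
  apply: (supnorm_le (p 0%N)) => x; have [i iJ ix] := tb_ball J x.
  have h1 := poly_near n ix; rewrite -/f in h1.
  have : normc (qi_val (qi_of_code (polyE n i J)) : R[i]) <= r.+1%:R / 2 ^+ k.+2.
    have c0 : 0 <= r.+1%:R / 2 ^+ k.+2 :> R by rewrite divr_ge0 ?ler0n // ltW.
    rewrite -ler_sqr ?nnegrE ?normc_ge0 // -rv_nsq.
    by apply: le_trans (normE_ge n iJ) (ltW hr).
  by have := normc_diff (f x) (qi_val (qi_of_code (polyE n i J))); lra.
(* By minimality r - 1 fails the test, so r 2^-(k+2) is at most the maximal approximate modulus,
   which exceeds the norm by at most 2^-(k+2). For r = 0 there is nothing to compare. *)
have lo : r%:R / 2 ^+ k.+2 <= supnorm f + 2 ^- k.+2.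
  case: r rmin {hr up} => [|r] rmin; first by rewrite mul0r addr_ge0 // ltW.
  have : ~~ root_test n k r by apply/negP => /rmin; rewrite ltnn.
  have B0 : 0 <= supnorm f + 2 ^- k.+2 by rewrite addr_ge0 // ltW.
  rewrite root_testP -leNgt -ler_sqr ?nnegrE ?divr_ge0 ?ler0n ?(ltW p0) // => /le_trans; apply.
  apply: normE_le => [|i]; first by rewrite exprn_ge0.
  rewrite rv_nsq ler_sqr ?nnegrE ?normc_ge0 //.
  (* Each centre lies in its own ball, so [poly_near] applies at p_i itself. *)
  have ix : d (p i) (p i) < 2 ^- J by rewrite (cmetric_refl hd) half_pow_gt0.
  have h1 := poly_near n ix; rewrite -/f normcB in h1.
  have h2 := normc_diff (qi_val (qi_of_code (polyE n i J))) (f (p i)).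
  by have := supnorm_ge hX hd f (p i); lra.
rewrite rv_dyadic ltr_distl.
have -> : 2 ^- k = 4 * 2 ^- k.+2 :> R by rewrite (half_powS R k) (half_powS R k.+1); ring.
have e1 : r.+1%:R / 2 ^+ k.+2 = r%:R / 2 ^+ k.+2 + 2 ^- k.+2 :> R.
  by rewrite -natr1 mulrDl mul1r.
by rewrite e1 in up; apply/andP; split; lra.
Qed.

Lemma gen_computable_norm : computable_reals (fun n => supnorm (rational_vector gen n)).
Proof.
have [c hc] : exists c, forall o n k, rec_eval o c [:: n; k] (qdyadic (root n k) k.+2).
  apply: (@cmp_code_pair (fun n k => qdyadic (root n k) k.+2)).
  by apply: cmp_qdyadic; [exact: cmp_root | cmp_auto].
by exists c => n k; exists (qdyadic (root n k) k.+2) => //; apply: root_near.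
Qed.

(** The minimum of the cones g(p_k) + L d(p_k, .) over the centres of a finite cover, with rational
    values close to g(p_k), capped by B. *)
Lemma gen_dense_real (g : X -> R) (B : nat) :
  (forall x, `|g x| <= B%:R) ->
  (forall e : R, 0 < e -> exists N, forall x y, d x y < 2 ^- N -> `|g x - g y| < e) ->
  forall e : R, 0 < e -> exists n, forall x, `|genv n x - g x| < e.
Proof.
move=> gB gu e e0.
have e4 : 0 < e / 4 by rewrite divr_gt0.
have [N hN] := gu _ e4.
(* With this slope a cone has risen by at least 2B at distance 2^-N from its apex, so it cannot fall
   noticeably below g there; nearer to the apex uniform continuity gives the lower bound. *)
pose L := (2 * B * 2 ^ N)%N.
(* [L.+1] rather than [L], which is zero when B is. *)
have eL : 0 < e / 4 / L.+1%:R by rewrite divr_gt0 // ltr0n.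
have [J0 hJ0] := half_pow_small eL.
(* The cover is so fine that the cone of a centre next to x has risen by less than e/4 at x; this
   gives the upper bound. *)
pose J := maxn N J0.
have hJ : L%:R * 2 ^- J < e / 4 :> R.
  have := hJ0 J (leq_maxr _ _); rewrite ltr_pdivlMr ?ltr0n // => h.
  apply: le_lt_trans h; rewrite mulrC ler_wpM2l ?(ltW (half_pow_gt0 _ _)) //.
  by rewrite ler_nat.
have NJ : 2 ^- J <= 2 ^- N :> R by apply: half_pow_le; apply: leq_maxl.
have [q hq] := choice (fun k => rv_dense (g (p k)) e4).
pose s := [seq pairn (pairn (q k) L) k | k <- CodeSeq.decode (tb J)].
exists (pairn (qnat B) (CodeSeq.code s)) => x.
rewrite /genv pairnK /= CodeSeq.codeK rv_nat.
have termE' k y : termv (pairn (pairn (q k) L) k) y = rv R (q k) + L%:R * d (p k) y.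
  by rewrite /termv /tq /tN /tk !pairnK.
have gx := gB x; rewrite ler_norml in gx; case/andP: gx => gx1 gx2.
rewrite ltr_distl; apply/andP; split.
  apply: (@lt_le_trans _ _ (g x - e / 2)); first by lra.
  apply: foldl_minr_ge => [|m /mapP [k kJ ->]]; first by lra.
  rewrite termE'; have := hq k; rewrite ltr_distl => /andP [q1 q2].
  have [kx|kx] := ltP (d (p k) x) (2 ^- N).
    have := hN _ _ kx; rewrite ltr_distl => /andP [g1 g2].
    have : 0 <= L%:R * d (p k) x by rewrite mulr_ge0 ?ler0n // (cmetric_ge0 hd).
    by lra.
  have : L%:R * 2 ^- N <= L%:R * d (p k) x by rewrite ler_wpM2l ?ler0n.
  have -> : L%:R * 2 ^- N = 2 * B%:R :> R.
    by rewrite /L !natrM natrX mulfK // expf_neq0 // pnatr_eq0.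
  by have := gB (p k); rewrite ler_norml => /andP [? ?]; lra.
have [k kJ kx] := tb_ball J x.
have ks : pairn (pairn (q k) L) k \in s by apply/mapP; exists k.
apply: le_lt_trans (foldl_minr_le _ _ ks) _; rewrite termE'.
have := hq k; rewrite ltr_distl => /andP [q1 q2].
have := hN _ _ (lt_le_trans kx NJ); rewrite ltr_distl => /andP [g1 g2].
have : L%:R * d (p k) x <= L%:R * 2 ^- J by rewrite ler_wpM2l ?ler0n // ltW.
by lra.
Qed.

Lemma gen_presentation : cstar_presentation gen.
Proof.
move=> f e e0; have e4 : 0 < e / 4 by rewrite divr_gt0.
have [B fB] := cstar_bounded hX hd f.
have [n1 h1] : exists n, forall x, `|genv n x - complex.Re (f x)| < e / 4.
  apply: (@gen_dense_real _ B) e4 => [x|t t0]; first exact: le_trans (normc_Re_le _) (fB x).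
  have [N hN] := cstar_unif hX hd f t0; exists N => x y /hN; apply: le_lt_trans.
  by rewrite -raddfB; apply: normc_Re_le.
have [n2 h2] : exists n, forall x, `|genv n x - complex.Im (f x)| < e / 4.
  apply: (@gen_dense_real _ B) e4 => [x|t t0]; first exact: le_trans (normc_Im_le _) (fB x).
  have [N hN] := cstar_unif hX hd f t0; exists N => x y /hN; apply: le_lt_trans.
  by rewrite -raddfB; apply: normc_Im_le.
(* The even letter code [n.*2] is x_n without adjoint. The vector below is 1 x_n1 + i x_n2,
   approximating real and imaginary parts separately. *)
pose t c n := pairn c (CodeSeq.code [:: n.*2]).
pose m := CodeSeq.code [:: t (pairn (qnat 1) (qnat 0)) n1; t (pairn (qnat 0) (qnat 1)) n2].
exists m; apply: (@le_lt_trans _ _ (e / 2)); last by lra.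
apply: (supnorm_le (p 0%N)) => x.
rewrite cstar_subE rational_vectorE /m CodeSeq.codeK !big_cons big_nil addr0.
rewrite /t /wcode !pairnK; cbn [fst snd];
  rewrite !CodeSeq.codeK /wordv !big_cons !big_nil !mulr1 !doubleK.
rewrite !normc_qi !pairnK /= !rv_nat.
move: (h1 x) (h2 x); case: (f x) => a b k1 k2; rewrite /= in k1 k2.
apply: le_trans (normc_l1 _) _; rewrite /=.
have -> : e / 2 = e / 4 + e / 4 by lra.
apply: lerD; apply: ltW.
  by rewrite (_ : _ - _ = genv n1 x - a) //; ring.
by rewrite (_ : _ - _ = genv n2 x - b) //; ring.
Qed.

End Existence.

(** * Uniqueness *)

Lemma cmp_size (A : Type) `{encodable A} D (f : (nat -> nat) -> A -> seq nat) :
  cmp D f -> cmp D (fun o a => size (f o a)).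
Proof.
move=> hf; apply: (@cmp_ext _ _ nat _ _ _ (fun o a => foldl (fun n _ => n.+1) 0%N (f o a))).
  by cmp_auto.
move=> o a _; rewrite -[LHS]add0n; elim: (f o a) 0%N => [|x s IH] n /=; first by rewrite addn0.
by rewrite -IH addnS.
Qed.
#[global] Hint Resolve cmp_size : cmp.

(** The numbers below n as a list, turning bounded quantifiers into [all] and [has]. *)
Definition countdown n : seq nat := iteri n (fun k s => k :: s) [::].

Lemma mem_countdown n k : (k \in countdown n) = (k < n)%N.
Proof. by elim: n => // n IH; rewrite in_cons IH ltnS [RHS]leq_eqVlt. Qed.

Lemma cmp_countdown (A : Type) `{encodable A} D (f : (nat -> nat) -> A -> nat) :
  cmp D f -> cmp D (fun o a => countdown (f o a)).
Proof. by move=> hf; rewrite /countdown; cmp_auto. Qed.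
#[global] Hint Resolve cmp_countdown : cmp.

Section Uniqueness.
Variables (R : realType) (X : topologicalType) (Xs : presented R X).
Hypothesis hX : compact [set: X].
Hypothesis hXs : space_presentation Xs.
Local Notation d := (pdist Xs).
Local Notation p := (ppoint Xs).
Variables (cd : recfun) (dq : nat -> nat -> nat -> nat).
Hypothesis dq_code : forall i j k, rec_eval no_oracle cd [:: i; j; k] (dq i j k).
Hypothesis dq_near : forall i j k, `|d (p i) (p j) - rv R (dq i j k)| < 2 ^- k.
Variable tb : nat -> nat.
Hypothesis tb_comp : computable_nat tb.
Hypothesis tb_cover : total_boundedness_function Xs tb.
Variables (pr : nat -> nat * nat) (prI : nat * nat -> nat).
Hypothesis prK : cancel pr prI.
Hypothesis prIK : cancel prI pr.
Hypothesis pr1_comp : computable_nat (fun n => (pr n).1).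
Hypothesis pr2_comp : computable_nat (fun n => (pr n).2).

Let hd : compatible_metric d := hXs.1.
Let cmp_dq' := @cmp_dq cd dq dq_code.
Let cmp_tb' := @cmp_tb tb tb_comp.
Hint Resolve cmp_dq' cmp_tb' : cmp.

Lemma cmp_prI (A : Type) `{encodable A} D (f g : (nat -> nat) -> A -> nat) :
  cmp D f -> cmp D g -> cmp D (fun o a => prI (f o a, g o a)).
Proof.
move=> hf hg; apply: (@cmp_app _ _ (nat * nat) nat _ _ D prI (fun o a => (f o a, g o a)));
  last by cmp_auto.
(* The inverse of [pr] is computed by searching through its values. *)
apply: (@cmp_mu _ _ _ _ (fun _ z n => ((pr n).1 == z.1) && ((pr n).2 == z.2))).
- apply: cmp_andb; apply: cmp_eqn; try by cmp_auto.
  + by apply: (@cmp_computable_nat _ _ _ (fun n => (pr n).1)) => //; cmp_auto.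
  + by apply: (@cmp_computable_nat _ _ _ (fun n => (pr n).2)) => //; cmp_auto.
- by move=> o z _; rewrite prIK !eqxx.
- move=> o [a b] m _ mlt; apply/negP => /= /andP [/eqP h1 /eqP h2].
  by move: mlt; rewrite -h1 -h2 -surjective_pairing prK ltnn.
Qed.
Hint Resolve cmp_prI : cmp.

(* The oracle (m, (s, k)) is the sequence s k k k ..., paired with the constant
   sequence m: it names (rho_m, p_k) as soon as s is an admissible beginning. *)
Definition oracle (z : nat * (seq nat * nat)) (i : nat) : nat :=
  prI (z.1, if (i < size z.2.1)%N then nth 0%N z.2.1 i else z.2.2).

Lemma cmp_oracle_param : cmp (fun _ _ => True)
  (fun (_ : nat -> nat) (z : nat * (seq nat * nat) * nat) => oracle z.1 z.2).
Proof. by rewrite /oracle; cmp_auto. Qed.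

(** A decidable condition with slack 2 * 2^-J: one 2^-J covers the error of [dq], the other is kept
    as a margin for moving from p_k to any point of B(p_k; 2^-J). *)
Definition admissible (s : seq nat) (k J : nat) : bool :=
  all (fun i => qle (qadd (dq (nth 0%N s i) k J) (qdyadic 2 J)) (qdyadic 1 i))
    (countdown (size s)).

Lemma admissibleP s k J i : admissible s k J -> (i < size s)%N ->
  d (p (nth 0%N s i)) (p k) + 2 ^- J < 2 ^- i.
Proof.
move=> /allP h il; have {h} := h i; rewrite mem_countdown => /(_ il).
rewrite (qleP R) rv_add !rv_dyadic mul1r => h.
by have := dq_near (nth 0%N s i) k J; rewrite ltr_distl => /andP [? ?]; lra.
Qed.

(** * Running an evaluator on finite beginnings of names *)

Section Eval.
Variables (u : nat -> cstar R X) (c : recfun).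
Hypothesis cP : forall x a, is_name (prod_presented pr (cstar_presented u) Xs) x a ->
  exists2 b, (forall k, rec_eval a c [:: k] (b k)) & is_name (@complex_presented R) (x.1 x.2) b.
Local Notation rho := (rational_vector u).

Lemma supnorm_sub_self (f : cstar R X) (e : R) : 0 < e -> supnorm (f - f) < e.
Proof.
move=> e0; apply: le_lt_trans e0; apply: (supnorm_le (p 0%N)) => x.
by rewrite cstar_subE subrr normc0.
Qed.

Lemma name_eval m x (i : nat -> nat) j : (forall k, d (p (i k)) x < 2 ^- k) ->
  exists2 y, rec_eval (fun k => prI (m, i k)) c [:: j] y &
    normc (rho m x - qi_val (qi_of_code y)) < 2 ^- j.
Proof.
move=> hi; have [|b hb nb] := @cP (rho m, x) (fun k => prI (m, i k)).
  move=> k; rewrite /= prIK /= gt_max hi andbT; apply: supnorm_sub_self; exact: half_pow_gt0.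
by exists (b j) => //; rewrite normcB; apply: nb.
Qed.

Definition peval m s k j := rec_val (oracle (m, (s, k))) c [:: j].
Definition puse m s k j := rec_use (oracle (m, (s, k))) c [:: j].

(** An admissible list continued by the constant k is a genuine name of p_k, so the evaluator halts
    on it. *)
Lemma admissible_dom m s k J j : admissible s k J -> rec_dom (oracle (m, (s, k))) c [:: j].
Proof.
move=> ad.
have [|y hy _] := @name_eval m (p k) (fun i => if (i < size s)%N then nth 0%N s i else k) j.
  move=> i; case: ifP => il; last by rewrite (cmetric_refl hd) half_pow_gt0.
  by have := admissibleP ad il; have := half_pow_gt0 R J; lra.
by exists y.
Qed.

(** By the margin in [admissible], s also begins a name of x. The run on that name reads only the
    part inside s and hence gives the same output. *)
Lemma peval_sound m s k J j x : admissible s k J -> (puse m s k j <= size s)%N ->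
  d (p k) x < 2 ^- J -> normc (rho m x - qi_val (qi_of_code (peval m s k j))) < 2 ^- j.
Proof.
move=> ad us kx.
have [i hi] := choice (fun l => hXs.2 x _ (half_pow_gt0 R l)).
pose t l := if (l < size s)%N then nth 0%N s l else i l.
have [|y hy ny] := @name_eval m x t j.
  move=> l; rewrite /t; case: ifP => ll //.
  by have := admissibleP ad ll; have := cmetric_tri hd (p k) (p (nth 0%N s l)) x; lra.
have ag l : (l < puse m s k j)%N -> prI (m, t l) = oracle (m, (s, k)) l.
  by move=> ll; rewrite /oracle /= /t (leq_trans ll us).
have [h _] := rec_use_agree (admissible_dom m j ad) ag.
by rewrite /peval -(rec_eval_functional hy h).
Qed.

(** A run on a full name reads finitely many entries, so every long enough beginning reproduces it,
    whatever constant k is appended. *)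
Lemma peval_complete m x (i : nat -> nat) j : (forall k, d (p (i k)) x < 2 ^- k) ->
  exists U y, normc (rho m x - qi_val (qi_of_code y)) < 2 ^- j /\
    forall n k, (U <= n)%N -> peval m (mkseq i n) k j = y /\ (puse m (mkseq i n) k j <= n)%N.
Proof.
move=> hi; have [y hy ny] := name_eval m j hi.
set o := fun k => _ in hy.
exists (rec_use o c [:: j]), y; split=> // n k Un.
have [||h1 h2] := @rec_use_agree o (oracle (m, (mkseq i n, k))) c [:: j].
- by exists y.
- move=> l ll; have ln := leq_trans ll Un.
  by rewrite /oracle /= size_mkseq ln nth_mkseq.
by rewrite /peval (rec_valE h1) (rec_valE hy) /puse h2.
Qed.

Section Cmp.
Context {A : Type} `{encodable A}.
Variables (D : (nat -> nat) -> A -> Prop) (fm fk fJ fj : (nat -> nat) -> A -> nat).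
Variable fs : (nat -> nat) -> A -> seq nat.
Hypothesis adD : forall o a, D o a -> admissible (fs o a) (fk o a) (fJ o a).

Lemma cmp_peval : cmp D fm -> cmp D fs -> cmp D fk -> cmp D fj ->
  cmp D (fun o a => peval (fm o a) (fs o a) (fk o a) (fj o a)).
Proof.
move=> hm hs hk hj; apply: (@cmp_rec_val_app _ _ (fun _ => oracle) cmp_oracle_param _ _ D c
  (fun o a => (fm o a, (fs o a, fk o a))) (fun o a => [:: fj o a])).
- by cmp_auto.
- by cmp_auto.
- by move=> o a /adD /admissible_dom; apply.
Qed.

Lemma cmp_puse : cmp D fm -> cmp D fs -> cmp D fk -> cmp D fj ->
  cmp D (fun o a => puse (fm o a) (fs o a) (fk o a) (fj o a)).
Proof.
move=> hm hs hk hj; apply: (@cmp_rec_use_app _ _ (fun _ => oracle) cmp_oracle_param _ _ D c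
  (fun o a => (fm o a, (fs o a, fk o a))) (fun o a => [:: fj o a])).
- by cmp_auto.
- by cmp_auto.
- by move=> o a /adD /admissible_dom; apply.
Qed.
End Cmp.

End Eval.

(** * Certificates of closeness *)

Definition close_codes j a b := qle
  (qadd (qabs (qadd (unpair a).1 (qopp (unpair b).1)))
        (qabs (qadd (unpair a).2 (qopp (unpair b).2)))) (qdyadic 8 j).

(** The sum of absolute parts replaces the modulus to stay rational. In [check_complete] the modulus
    is below 3 * 2^-j, hence this sum below 6 * 2^-j; 8 leaves room. *)
Lemma close_codesE j a b : close_codes j a b =
  let z := qi_val (qi_of_code a) - qi_val (qi_of_code b) : R[i] in
  (`|complex.Re z| + `|complex.Im z| <= 8 * 2 ^- j).
Proof. by rewrite /close_codes (qleP R) rv_add !rv_abs !rv_add !rv_opp rv_dyadic. Qed.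

Variables (u v : nat -> cstar R X) (cu cv : recfun).
Hypothesis cuP : forall x a, is_name (prod_presented pr (cstar_presented u) Xs) x a ->
  exists2 b, (forall k, rec_eval a cu [:: k] (b k)) & is_name (@complex_presented R) (x.1 x.2) b.
Hypothesis cvP : forall x a, is_name (prod_presented pr (cstar_presented v) Xs) x a ->
  exists2 b, (forall k, rec_eval a cv [:: k] (b k)) & is_name (@complex_presented R) (x.1 x.2) b.
Hypothesis v_dense : cstar_presentation v.

(** The order matters: admissibility is decided first and guarantees that the evaluators halt. *)
Definition local_check m n j J k s :=
  admissible s k J && ((puse cu m s k j <= size s)%N && ((puse cv n s k j <= size s)%N &&
    close_codes j (peval cu m s k j) (peval cv n s k j))).

(* [N] codes the triple (n, J, list of beginnings of names). *)
Definition check m j N :=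
  let n := (unpair N).1 in let J := (unpair (unpair N).2).1 in
  all (fun k => has (fun s => local_check m n j J k (CodeSeq.decode s))
                    (CodeSeq.decode (unpair (unpair N).2).2)) (CodeSeq.decode (tb J)).

(** The constant is 1 + 8 + 1: two evaluation errors and the tolerance of [close_codes]. *)
Lemma check_sound m j N x : check m j N ->
  normc (rational_vector u m x - rational_vector v (unpair N).1 x) <= 10 * 2 ^- j.
Proof.
rewrite /check; set n := (unpair N).1; set J := (unpair (unpair N).2).1 => /allP h.
have [k kJ kx] := tb_ball tb_cover J x.
have /hasP [s _] := h k kJ; set s' := CodeSeq.decode s.
case/and4P => ad uu uv; rewrite close_codesE; cbv zeta.
set y := qi_val _; set z := qi_val _ => cl.
have hu := peval_sound cuP ad uu kx; have hv := peval_sound cvP ad uv kx.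
have := normc_tri (rational_vector u m x) y (rational_vector v n x).
have := normc_tri y z (rational_vector v n x); have := normc_l1 (y - z).
rewrite (normcB z (rational_vector v n x)); rewrite -/y in hu; rewrite -/z in hv; lra.
Qed.

Lemma check_complete m j : exists N, check m j N.
Proof.
have [n hn] := v_dense (rational_vector u m) (half_pow_gt0 R j).
(* Near each x one beginning s serves all nearby centres at all high precisions. Bounding its code
   by the stage makes a uniform stage N bound all the beginnings used. *)
have [|N hN] := @compact_eventually _ _ d hX hd (fun N x => exists2 s, (CodeSeq.code s < N)%N &
   forall J k, (N <= J)%N -> d (p k) x < 2 ^- N -> local_check m n j J k s).
  move=> x; have [i hi] := choice (fun l => hXs.2 x _ (half_pow_gt0 R l)).
  have [U [y [ny hU]]] := peval_complete cuP m j hi.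
  have [V [z [nz hV]]] := peval_complete cvP n j hi.
  pose W := maxn U V.
  (* Finitely many strict inequalities leave a common slack e, to be spent on replacing x by p_k and
     on the errors in [admissible]. *)
  have [e e0 he] : exists2 e : R, 0 < e & forall l, (l < W)%N -> d (p (i l)) x + e < 2 ^- l.
    elim: W => [|W [e e0 he]]; first by exists 1.
    have g0 : 0 < 2 ^- W - d (p (i W)) x by rewrite subr_gt0.
    exists (Num.min e ((2 ^- W - d (p (i W)) x) / 2)); first by rewrite lt_min e0 divr_gt0.
    move=> l; rewrite ltnS leq_eqVlt => /orP [/eqP -> | /he h].
      have : Num.min e ((2 ^- W - d (p (i W)) x) / 2) <= (2 ^- W - d (p (i W)) x)
        / 2 by rewrite ge_min lexx orbT.
      by lra.
    have : Num.min e ((2 ^- W - d (p (i W)) x) / 2) <= e by rewrite ge_min lexx.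
    by lra.
  have e8 : 0 < e / 8 by rewrite divr_gt0.
  have [N0 hN0] := half_pow_small e8.
  exists (e / 8) => //; exists (maxn N0 (CodeSeq.code (mkseq i W)).+1) => N' x' NN xx'.
  exists (mkseq i W); first by apply: leq_trans NN; apply: leq_maxr.
  move=> J k NJ kx.
  have sN := hN0 N' (leq_trans (leq_maxl _ _) NN).
  have sJ : 2 ^- J < e / 8 by apply: hN0; apply: leq_trans NJ; apply: leq_trans NN;
    apply: leq_maxl.
  have dk : d x (p k) < e / 4.
    by have := cmetric_tri hd x' x (p k); rewrite (cmetric_sym hd x' (p k)); lra.
  have [E1 E2] := hU W k (leq_maxl _ _); have [E3 E4] := hV W k (leq_maxr _ _).
  rewrite /local_check size_mkseq E2 E4 E1 E3 /=; apply/andP; split.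
    apply/allP => l; rewrite size_mkseq mem_countdown => lW.
    rewrite nth_mkseq // (qleP R) rv_add !rv_dyadic mul1r.
    have := dq_near (i l) k J; rewrite ltr_distl => /andP [? ?].
    by have := he l lW; have := cmetric_tri hd x (p (i l)) (p k); lra.
  rewrite close_codesE; cbv zeta; set a := qi_val _ in ny *; set b := qi_val _ in nz *.
  have h1 := normc_Re_le (a - b); have h2 := normc_Im_le (a - b).
  set f := rational_vector u m in hn ny; set g := rational_vector v n in hn nz.
  have h3 := supnorm_ge hX hd (g - f) x; rewrite cstar_subE in h3.
  have h4 := normc_tri a (f x) b; rewrite (normcB a (f x)) in h4.
  have h5 := normc_tri (f x) (g x) b; rewrite (normcB (f x) (g x)) in h5.
  by rewrite /= -/f -/g in hn; have := half_pow_gt0 R j; lra.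
(* Precision J = N, and all lists with code below N as possible beginnings. *)
exists (pairn n (pairn N (CodeSeq.code (countdown N)))).
rewrite /check !pairnK /= CodeSeq.codeK; apply/allP => k _; apply/hasP.
have [s sN hs] := hN N (p k) (leqnn _).
exists (CodeSeq.code s); first by rewrite mem_countdown.
by rewrite CodeSeq.codeK; apply: hs => //; rewrite (cmetric_refl hd) half_pow_gt0.
Qed.

Lemma cmp_check : cmp (fun _ _ => True)
  (fun (_ : nat -> nat) (z : (nat * nat) * nat) => check z.1.1 z.1.2 z.2).
Proof.
rewrite /check; cbv zeta; apply: cmp_all; first by cmp_auto.
apply: cmp_has; first by cmp_auto.
rewrite /local_check; apply: cmp_andb; first by rewrite /admissible; cmp_auto.
apply: cmp_andb.
  apply: cmp_leq; last by cmp_auto.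
  apply: (cmp_puse cuP (fJ := fun _ a => (unpair (unpair a.1.1.2).2).1)); try cmp_auto.
  by move=> o a [].
apply: cmp_andb.
  apply: cmp_leq; last by cmp_auto.
  apply: (cmp_puse cvP (fJ := fun _ a => (unpair (unpair a.1.1.2).2).1)); try cmp_auto.
  by move=> o a [[]].
rewrite /close_codes; apply: cmp_qle; last by cmp_auto.
(* The domain is the chain of tests already passed; its first member, admissibility, is what makes
   [peval] defined. *)
have hu : cmp (fun o (a : nat * nat * nat * nat * nat) => ((True
  /\ admissible (CodeSeq.decode a.2) a.1.2 (unpair (unpair a.1.1.2).2).1) /\
   (puse cu a.1.1.1.1 (CodeSeq.decode a.2) a.1.2 a.1.1.1.2 <= size (CodeSeq.decode a.2))%N) /\
   (puse cv (unpair a.1.1.2).1 (CodeSeq.decode a.2)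
     a.1.2 a.1.1.1.2 <= size (CodeSeq.decode a.2))%N)
  (fun o a => peval cu a.1.1.1.1 (CodeSeq.decode a.2) a.1.2 a.1.1.1.2).
  apply: (cmp_peval cuP (fJ := fun _ a => (unpair (unpair a.1.1.2).2).1)); try cmp_auto.
  by move=> o a [[[]]].
have hv : cmp (fun o (a : nat * nat * nat * nat * nat) => ((True
  /\ admissible (CodeSeq.decode a.2) a.1.2 (unpair (unpair a.1.1.2).2).1) /\
   (puse cu a.1.1.1.1 (CodeSeq.decode a.2) a.1.2 a.1.1.1.2 <= size (CodeSeq.decode a.2))%N) /\
   (puse cv (unpair a.1.1.2).1 (CodeSeq.decode a.2)
     a.1.2 a.1.1.1.2 <= size (CodeSeq.decode a.2))%N)
  (fun o a => peval cv (unpair a.1.1.2).1 (CodeSeq.decode a.2) a.1.2 a.1.1.1.2).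
  apply: (cmp_peval cvP (fJ := fun _ a => (unpair (unpair a.1.1.2).2).1)); try cmp_auto.
  by move=> o a [[[]]].
cmp_auto.
Qed.

Definition certificate m j := ex_minn (check_complete m j).

Lemma cmp_certificate : cmp (fun _ _ => True) (fun (_ : nat -> nat) z => certificate z.1 z.2).
Proof.
apply: (@cmp_mu _ _ _ _ (fun _ z N => check z.1 z.2 N)).
- by apply: cmp_sub cmp_check _.
- by move=> _ [m j] _ /=; rewrite /certificate; case: ex_minnP.
- move=> _ [m j] N _ /=; rewrite /certificate; case: ex_minnP => r _ h mr.
  by apply/negP => /h; rewrite leqNgt mr.
Qed.

Lemma identity_computable : computable_map (cstar_presented u) (cstar_presented v) id.
Proof.
have [c hc] : cmp (fun _ _ => True)
  (fun (o : nat -> nat) k => (unpair (certificate (o k.+1) (k + 5)%N)).1).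
  apply: cmp_fst; apply: cmp_unpair.
  by apply: (cmp_comp cmp_certificate (f := fun o k => (o k.+1, (k + 5)%N))) => //; cmp_auto.
exists c => f a ha; exists (fun k => (unpair (certificate (a k.+1) (k + 5)%N)).1).
  by move=> k; apply: hc.
move=> k /=; set N := certificate _ _.
have cN : check (a k.+1) (k + 5)%N N by rewrite /N /certificate; case: ex_minnP.
have := ha k.+1; rewrite /=; set r := rational_vector u _ => hr.
set q := rational_vector v _.
(* The certificate costs 10/32 of 2^-k and the distance from r to f less than 1/2 of it, in total
   less than 2^-k. *)
apply: (@le_lt_trans _ _ (10 * 2 ^- (k + 5) + supnorm (r - f))).
  apply: (supnorm_le (p 0%N)) => x; rewrite cstar_subE.
  have h1 := check_sound x cN; rewrite -/r -/q in h1.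
  have h2 := supnorm_ge hX hd (r - f) x; rewrite cstar_subE in h2.
  by have := normc_tri (q x) (r x) (f x); rewrite (normcB (q x) (r x)); lra.
have e1 : 2 ^- (k + 5) = 2 ^- k / 32 :> R.
  by rewrite half_powD; congr (_ * _); rewrite -natrX.
rewrite e1; have := half_powS R k; have := half_pow_gt0 R k; lra.
Qed.

End Uniqueness.

Theorem theorem1p3 (R : realType) (X : topologicalType)
    (hX : compact [set: X]) (hP : polish R X)
    (Xs : presented R X) (hXs : space_presentation Xs)
    (hc : computably_compact Xs)
    (pr : nat -> nat * nat) (hpr : computable_bijection pr) :
  (exists u : nat -> cstar R X,
     computable_cstar_presentation u /\ evaluative pr u Xs) /\
  (forall u v : nat -> cstar R X,
     computable_cstar_presentation u -> evaluative pr u Xs ->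
     computable_cstar_presentation v -> evaluative pr v Xs ->
     computably_isometrically_isomorphic u v).
Proof.
have [[cd hcd] [tb tb_comp tb_cover]] := hc.
(* Choice only names the outputs of [cd] as a function [dq]; these are still the values computed by
   the program. *)
have [dq3 dqP] := choice (fun z : nat * (nat * nat) =>
  let: ex_intro2 q hq hn := hcd z.1 z.2.1 z.2.2 in ex_intro _ q (conj hq hn)).
pose dq i j k := dq3 (i, (j, k)).
have dq_code i j k : rec_eval no_oracle cd [:: i; j; k] (dq i j k) := (dqP (i, (j, k))).1.
have dq_near i j k : `|pdist Xs (ppoint Xs i) (ppoint Xs j) - rv R (dq i j k)| < 2 ^- k
  := (dqP (i, (j, k))).2.
have [[prI prK prIK] pr1 pr2] := hpr.
split.
  have [M hM] := metric_bounded hX hXs.1.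
  exists (gen hXs M); split; last by apply: (gen_evaluative hX hXs dq_code dq_near hM).
  split; first by apply: (gen_presentation hX hXs tb_cover).
  by apply: (gen_computable_norm hX hXs dq_code dq_near tb_comp tb_cover hM).
move=> u v _ [cu cuP] [v_dense _] [cv cvP]; exists id; split.
- split=> //; first by exists id.
- by [].
- exact: (identity_computable hX hXs dq_code dq_near tb_comp tb_cover prK prIK pr1 pr2 cuP cvP
  v_dense).
Qed.
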